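(* Let $f(z)=(z-\alpha_1)^{n_1}\cdots(z-\alpha_s)^{n_s}\in\mathbb{C}[z]$, where $s\ge 2$, $\alpha_1,\dots,\alpha_s$ are distinct complex numbers and $n_1,\dots,n_s$ are positive integers. Let $\mathcal{K}$ be the convex hull of $\{\alpha_1,\dots,\alpha_s\}$, and let $R$ be the radius of a closed disk in $\mathbb{C}$ containing $\mathcal{K}$. Suppose that a path of steepest descent for $|f|$ links a point $\beta$ of $\mathcal{K}$ to a root $\alpha$ of $f$ which lies on the boundary of $\mathcal{K}$. Then this path has length at most $2\pi sR$.
   Context: A path of steepest descent (resp. steepest ascent) for $|f|$ is a continuous piecewise differentiable curve $\gamma\colon I\to\mathbb{C}$, defined on an interval $I$ of $\mathbb{R}$, which is an integral curve for the gradient of $|f|$, and along which $|f|$ is decreasing (resp. increasing). Such curves are considered up to reparametrization, and they may pass through or end at zeros of $f'$ and end at zeros of $f$; the gradient condition applies away from the zeros of $f$ and $f'$. The boundary of $\mathcal{K}$ is its topological boundary in $\mathbb{C}$. *)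

(* Defs.v *)
From HB Require Import structures.
From mathcomp Require Import all_boot all_order all_algebra.
From mathcomp Require Import all_classical all_reals all_analysis.
From mathcomp.real_closed Require Export complex.

Set Implicit Arguments.
Unset Strict Implicit.
Unset Printing Implicit Defensive.

Import Order.TTheory GRing.Theory Num.Theory numFieldNormedType.Exports.

Local Open Scope classical_set_scope.
Local Open Scope ring_scope.
Local Open Scope complex_scope.

(* The complex plane is [Rcomplex R]: the field [R[i]] seen as an [R]-module
   normed by the real-valued modulus [normc].  The instances below give it the
   topology of this norm, so that curves [R -> Rcomplex R] and functions
   [Rcomplex R -> R] have real derivatives.
   Pitfall: since [Rcomplex R] unfolds to [R[i]], the notation for norms may
   pick the [R[i]]-valued norm; the modulus is therefore always written
   [normc]. *)
HB.instance Definition _ (R : realType) :=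
  PseudoMetric.copy (Rcomplex R) (pseudoMetric_normed (Rcomplex R)).

HB.instance Definition _ (R : realType) := isPointed.Build (Rcomplex R) 0.

HB.instance Definition _ (R : realType) :=
  NormedZmod_PseudoMetric_eq.Build R (Rcomplex R) erefl.

Lemma Rcomplex_normZ (R : realType) (l : R) (x : Rcomplex R) :
  `|l *: x| = `|l| * `|x|.
Proof.
case: x => a b; rewrite /Num.norm /= -[RHS]/(`|l| * _).
by rewrite !exprMn -mulrDr sqrtrM ?sqr_ge0// sqrtr_sqr.
Qed.

HB.instance Definition _ (R : realType) :=
  PseudoMetricNormedZmod_Lmodule_isNormedModule.Build R (Rcomplex R)
    (@Rcomplex_normZ R).

Notation normc := ComplexField.Normc.normc.

Definition convex_hull (R : realType) (s : nat) (alpha : 'I_s -> Rcomplex R) :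
    set (Rcomplex R) :=
  [set z | exists w : 'I_s -> R,
    [/\ forall i, 0 <= w i, \sum_(i < s) w i = 1
      & z = \sum_(i < s) w i *: alpha i]].

Definition boundary (T : topologicalType) (A : set T) : set T :=
  closure A `\` interior A.

Definition poly_modulus (R : realType) (f : {poly (Rcomplex R)})
    (z : Rcomplex R) : R :=
  normc f.[z].

Definition gradient (R : realType) (g : Rcomplex R -> R) (z : Rcomplex R) :
    Rcomplex R :=
  'D_((1 +i* 0) : Rcomplex R) g z +i* 'D_((0 +i* 1) : Rcomplex R) g z.

(* [gamma], restricted to [a, b], is a path of steepest descent for |f|.
   The finite sequence [cuts] contains the points of a subdivision where
   [gamma] need not be differentiable.  Curves are taken up to
   reparametrization, hence the arbitrary speed [c > 0]: away from the zeros of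
   f and f', the velocity is a positive multiple of minus the gradient. *)
Definition steepest_descent_path (R : realType) (f : {poly (Rcomplex R)})
    (a b : R) (gamma : R -> Rcomplex R) : Prop :=
  [/\ {within `[a, b], continuous gamma},
      {in `[a, b] &, forall t u : R,
        t < u -> poly_modulus f (gamma u) < poly_modulus f (gamma t)}
    & exists cuts : seq R, forall t : R, t \in `]a, b[ -> t \notin cuts ->
        derivable gamma t 1 /\
        (f.[gamma t] != 0 -> (f^`()%R).[gamma t] != 0 ->
         exists2 c : R, 0 < c &
           'D_1 gamma t = - (c *: gradient (poly_modulus f) (gamma t)))].

(* Length as the supremum of the lengths of inscribed polygonal lines; it is
   the analogue for plane curves of [total_variation]. *)
Definition polygon_length (R : realType) (a b : R) (gamma : R -> Rcomplex R)
    (p : seq R) : R :=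
  let F := gamma \o nth b (a :: p) in
  \sum_(0 <= k < size p) normc (F k.+1 - F k).

Definition curve_length (R : realType) (a b : R) (gamma : R -> Rcomplex R) :
    \bar R :=
  ereal_sup [set (polygon_length a b gamma p)%:E | p in itv_partition a b].

(* Main.v *)
Require Import Defs.
From HB Require Import structures.
From mathcomp Require Import all_boot all_order all_algebra.
From mathcomp Require Import all_classical all_reals all_analysis.
From mathcomp.real_closed Require Import complex.
From mathcomp Require Import lra ring.

Set Implicit Arguments.
Unset Strict Implicit.
Unset Printing Implicit Defensive.

Import Order.TTheory GRing.Theory Num.Theory numFieldNormedType.Exports.

Local Open Scope classical_set_scope.
Local Open Scope ring_scope.

(* By the Cauchy-Crofton formula it suffices to show that a generic line meets
   the path at most [2 s - 1] times.  Take a horizontal line; along it,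
   [d (arg f) / dx] is, up to sign, the vertical slope of [log |f|], whose zeros
   are those of a polynomial of degree at most [2 s - 2].  So it is enough that
   this slope vanishes between any two points of the path on the line.

   If it does not, two neighbouring such points, reached at the times
   [t1 < t2], bound a segment which the path crosses, say, upwards at both
   ends and through which [|f|] increases downwards.  The arc from [t1] to [t2]
   and the segment form a closed curve.  The path after [t2] leads to [alpha],
   which is on the boundary of the hull containing the curve, hence outside the
   curve; so the points just above the segment have winding number 0 and the
   points just below it have not.  Then [|f|] has no maximum on the compact set
   of the points that are on the curve or have nonzero winding number: not off
   the curve by the maximum principle, not on the arc since [|f|] is larger at
   [t1], and not on the segment since [|f|] increases just below it.

   Winding numbers are only needed modulo 2: the winding number around [z] is
   even when [w - z] has a continuous square root along the curve. *)

(** Length is that of inscribed polygons, and Cauchy-Crofton is proved for these without integrals: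
    an integral bound becomes the statement that an explicit primitive minus a linear function is
    nonincreasing. The hull has width at most 2R in each direction of a half turn, so 2 s - 1
    crossings bound twice the length by pi (2 s - 1) 2R; rounding 2 s - 1 up to 2 s gives the
    constant.

    One obstacle is that a line may a priori be met tangentially or at an exceptional time, whereas
    only transversal crossings can be counted. So the lines are first taken for the polygon; for
    each of them a nearby line is found which the path crosses transversally during every time
    interval whose side met the original line, and which avoids finitely many bad heights.

    Neighbouring points are adjacent on the line, not in time. A nearest one exists because
    transversality isolates a crossing in time, so that the other candidates form a compact set.

    The curve stays in the hull because, beyond a line that leaves all roots on one side, descent
    leads back towards that side. All directions reduce to the horizontal one by rotating the roots
    and the path together. *)

Local Notation Re := complex.Re.
Local Notation Im := complex.Im.

(** * Continuity of real-valued functions *)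

Section Continuity.
Variables (R : realType) (T : topologicalType).
Implicit Types f g : T -> R.

Lemma continuous_ext f g : (forall x, f x = g x) -> continuous f -> continuous g.
Proof. by move=> /funext ->. Qed.

Lemma continuous_add f g :
  continuous f -> continuous g -> continuous (fun x => f x + g x).
Proof. by move=> cf cg x; exact: cvgD (cf x) (cg x). Qed.

Lemma continuous_opp f : continuous f -> continuous (fun x => - f x).
Proof. by move=> cf x; exact: cvgN (cf x). Qed.

Lemma continuous_mul f g :
  continuous f -> continuous g -> continuous (fun x => f x * g x).
Proof. by move=> cf cg x; exact: cvgM (cf x) (cg x). Qed.

Lemma continuous_maxr f g :
  continuous f -> continuous g -> continuous (fun x => Num.max (f x) (g x)).
Proof. by move=> cf cg x; exact: (continuous_max (cf x) (cg x)). Qed.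

Lemma continuous_minr f g :
  continuous f -> continuous g -> continuous (fun x => Num.min (f x) (g x)).
Proof. by move=> cf cg x; exact: (continuous_min (cf x) (cg x)). Qed.

Lemma continuous_sqr f : continuous f -> continuous (fun x => f x ^+ 2).
Proof. by move=> cf; exact: continuous_mul. Qed.

Lemma continuous_comp_real f (h : R -> R) :
  continuous h -> continuous f -> continuous (fun x => h (f x)).
Proof. by move=> ch cf x; exact: (continuous_comp (cf x) (ch _)). Qed.

Lemma continuous_fsum (I : Type) (r : seq I) (F : I -> T -> R) :
  (forall i, continuous (F i)) -> continuous (fun x => \sum_(i <- r) F i x).
Proof.
move=> cF; elim: r => [|i r IH].
  by under eq_fun do rewrite big_nil; move=> x; exact: cvg_cst.
by under eq_fun do rewrite big_cons; exact: continuous_add.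
Qed.

Lemma continuous_fprod (I : Type) (r : seq I) (F : I -> T -> R) :
  (forall i, continuous (F i)) -> continuous (fun x => \prod_(i <- r) F i x).
Proof.
move=> cF; elim: r => [|i r IH].
  by under eq_fun do rewrite big_nil; move=> x; exact: cvg_cst.
by under eq_fun do rewrite big_cons; exact: continuous_mul.
Qed.

End Continuity.

Ltac cont := try assumption; try match goal with
  | |- continuous (fun=> ?z) => move=> ?; exact: cvg_cst
  | |- continuous (fun x => x) => move=> ?; exact: cvg_id
  | |- continuous (cst ?z) => move=> ?; exact: cvg_cst
  | |- continuous id => move=> ?; exact: cvg_id
  | |- continuous (fun x => @?f x + @?g x) => apply: (@continuous_add _ _ f g); cont
  | |- continuous (fun x => - @?f x) => apply: (@continuous_opp _ _ f); cont
  | |- continuous (fun x => @?f x ^+ 2) => apply: (@continuous_sqr _ _ f); cont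
  | |- continuous (fun x => @?f x * @?g x) => apply: (@continuous_mul _ _ f g); cont
  end.

(** * Monotonicity, primitives and the Cauchy-Crofton inequality *)

Section RealAnalysis.
Variable R : realType.
Implicit Types (f h : R -> R) (a b c x y : R).

(** Cutting at an exceptional point shortens the list of these points, and continuity is enough to
    glue the two halves. This lemma stands in for integration in what follows. *)
Lemma le_of_derive_le0_finite f a b (E : set R) : a <= b -> continuous f ->
  finite_set E ->
  (forall x, a < x < b -> ~ E x -> exists2 d, d <= 0 & is_derive x 1 f d) ->
  f b <= f a.
Proof.
move=> ab cf /finite_seqP[s ->{E}].
elim: s a b ab => [|e s IH] a b ab df.
  have dr x : x \in `]a, b[%R -> derivable f x 1.
    by rewrite in_itv/= => xab; have [//|d _ []] := df x xab _.
  have dr0 x : x \in `]a, b[%R -> f^`()%classic x <= 0.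
    rewrite in_itv/= => xab; have [//|d d0 [_ dE]] := df x xab _.
    by rewrite derive1E dE.
  apply: (ler0_derive1_le_cc dr dr0 (continuous_subspaceT cf)) => //.
    by rewrite in_itv/= lexx ab.
  by rewrite in_itv/= lexx ab.
have [eab|eab] := boolP (a < e < b); last first.
  apply: IH => // x xab xs; apply: df => //=; rewrite inE => /predU1P[xe|//].
  by rewrite -xe xab in eab.
have /andP[ae eb] := eab.
apply: (@le_trans _ _ (f e)); apply: IH; rewrite ?ltW// => x /andP[x1 x2] xs.
  apply: df => /=; first by rewrite (lt_trans ae x1).
  by rewrite inE => /predU1P[xe|//]; rewrite xe ltxx in x1.
apply: df => /=; first by rewrite x1 (lt_trans x2 eb).
by rewrite inE => /predU1P[xe|//]; rewrite xe ltxx in x2.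
Qed.

(** The time is the largest point of the compact set where [h <= c]; if [h] were below [c] there,
    the intermediate value theorem would give a larger one. *)
Lemma last_exit h a b c : a <= b -> continuous h -> h a <= c -> c < h b ->
  exists s, [/\ a <= s < b, h s = c & forall t, s < t <= b -> c < h t].
Proof.
move=> ab ch hac chb.
pose A := `[a, b] `&` (h @^-1` [set x | x <= c]).
have A0 : A !=set0 by exists a; split=> //=; rewrite in_itv/= lexx.
have cA : compact A.
  apply: (subclosed_compact _ (@segment_compact _ a b)); last by move=> x [].
  apply: closedI; first exact: itv_closed.
  by apply: (@preimage_closed _ _ h) => //; exact: closed_le.
have [s] := compact_EVT_max A0 cA (@continuous_subspaceT _ _ A id (fun x => cvg_id)).
rewrite inE => -[/=]; rewrite in_itv/= => /andP[sa sb] hsc smax.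
have lec t : s < t <= b -> c < h t.
  move=> /andP[st tb]; rewrite ltNge; apply/negP => htc.
  suff : t <= s by rewrite leNgt st.
  apply: smax; rewrite inE; split=> //=.
  by rewrite in_itv/= tb (le_trans sa (ltW st)).
have sb' : s < b.
  by rewrite lt_neqAle sb andbT; apply/eqP => sbE; rewrite -sbE ltNge hsc in chb.
exists s; split=> //; first by rewrite sa.
apply/eqP; rewrite eq_le hsc/=.
have hc : Num.min (h s) (h b) <= c <= Num.max (h s) (h b).
  by rewrite ge_min hsc/= le_max (ltW chb) orbT.
have [t] := @IVT _ h s b c (ltW sb') (continuous_subspaceT ch) hc.
rewrite in_itv/= => /andP[st tb] htc.
have [->|ts] := eqVneq s t; first by rewrite htc.
have : c < h t by apply: lec; rewrite tb andbT lt_neqAle ts.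
by rewrite htc ltxx.
Qed.

Lemma continuous_clamp a b : continuous (fun y => Num.max a (Num.min y b)).
Proof. by apply: continuous_maxr; [cont | apply: continuous_minr; cont]. Qed.

Lemma is_derive_clamp a b y : a <= b -> y != a -> y != b ->
  is_derive y 1 (fun z : R => Num.max a (Num.min z b)) (a < y < b)%R%:R.
Proof.
move=> ab ya yb.
have [yltb|ygtb] := ltP y b; last first.
  have {}ygtb : b < y by rewrite lt_neqAle eq_sym yb.
  rewrite andbF mulr0n; apply: (@near_eq_is_derive _ _ _ (cst b)).
  near=> z; rewrite min_r ?max_r//; apply/ltW; near: z; exact: lt_nbhsr.
have [alty|agty] := ltP a y; last first.
  have {}agty : y < a by rewrite lt_neqAle ya.
  rewrite mulr0n; apply: (@near_eq_is_derive _ _ _ (cst a)).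
  near=> z; rewrite max_l//= ge_min; apply/orP; left; apply/ltW; near: z; exact: lt_nbhsl.
rewrite mulr1n; apply: (@near_eq_is_derive _ _ _ id).
near=> z; rewrite min_l ?max_r//; apply/ltW; near: z; [exact: lt_nbhsr|exact: lt_nbhsl].
Unshelve. all: by end_near. Qed.

Lemma is_derive_cmul f c x d :
  is_derive x 1 f d -> is_derive x 1 (fun y => c * f y) (c * d).
Proof. exact: is_deriveZ. Qed.

Lemma is_derive_fsum (I : Type) (r : seq I) (F : I -> R -> R) (dF : I -> R) x :
  (forall i, is_derive x 1 (F i) (dF i)) ->
  is_derive x 1 (fun x => \sum_(i <- r) F i x) (\sum_(i <- r) dF i).
Proof.
move=> cF; elim: r => [|i r IH].
  rewrite big_nil; under eq_fun do rewrite big_nil; exact: is_derive_cst.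
rewrite big_cons; under eq_fun do rewrite big_cons.
exact: is_deriveD.
Qed.

(* The functions [max lo_k (min y hi_k)] have slope 1 between [lo_k] and
   [hi_k] and 0 elsewhere, so their sum minus [N y] is nonincreasing. *)
Lemma sum_lengths_le (m : nat) (lo hi : 'I_m -> R) (N : nat) c d (V : set R) :
  c <= d -> (forall k, c <= lo k) -> (forall k, lo k <= hi k) ->
  (forall k, hi k <= d) -> finite_set V ->
  (forall y, ~ V y -> (#|[set k | (lo k < y < hi k)%R]%SET| <= N)%N) ->
  \sum_k (hi k - lo k) <= N%:R * (d - c).
Proof.
move=> cd clo lohi hid finV VN.
pose F y := \sum_k (Num.max (lo k) (Num.min y (hi k))) + - N%:R * y.
have : F d <= F c.
  pose E := V `|` (range lo `|` range hi).
  apply: (@le_of_derive_le0_finite F c d E) => //.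
  - apply: continuous_add; first by apply: continuous_fsum => k; exact: continuous_clamp.
    by move=> y; apply: cvgM; [exact: cvg_cst | exact: cvg_id].
  - by rewrite !finite_setU; split=> //; split; exact: finite_image.
  - move=> y _ nE; exists (\sum_k (lo k < y < hi k)%R%:R - N%:R).
      rewrite subr_le0 -natr_sum ler_nat.
      have nV : ~ V y by move=> Vy; apply: nE; left.
      apply: leq_trans (VN _ nV); rewrite -sum1_card [leqRHS]big_mkcond/=.
      by apply: leq_sum => k _; rewrite inE; case: ifP.
    apply: is_deriveD.
      apply: is_derive_fsum => k; apply: is_derive_clamp => //.
        by apply/eqP => yk; apply: nE; right; left; exists k.
      by apply/eqP => yk; apply: nE; right; right; exists k.
    by rewrite -[X in is_derive _ _ _ X]mulr1; apply: is_derive_cmul; exact: is_derive_id.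
rewrite /F.
under eq_bigr do rewrite min_r// max_r//.
under [in leRHS]eq_bigr => k _.
  rewrite min_l; last by rewrite (le_trans (clo k)).
  rewrite max_l//; over.
rewrite sumrB; lra.
Qed.

(** The sinusoid takes the opposite values [a] and [- a] at 0 and [pi], so it vanishes at some [p]
    between them and equals [rho * sin (x - p)], where [|rho|] is the square root of [a^2 + b^2]. In
    this range its sign can change only at [p], where [min] and [max] glue the primitives of the two
    sides. *)
Lemma primitive_abs_sinusoid a b : exists (F : R -> R) (p : R),
  [/\ continuous F, F pi - F 0 = 2 * Num.sqrt (a ^+ 2 + b ^+ 2)
    & forall x, 0 < x < pi -> x != p ->
        is_derive x 1 F `|a * cos x + b * sin x| ].
Proof.
have cg : continuous (fun x : R => a * cos x + b * sin x).
  by cont; [exact: continuous_cos | exact: continuous_sin].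
have [||p /[!in_itv]/= /andP[p0 ppi] gp] :=
    @IVT _ (fun x : R => a * cos x + b * sin x) 0 pi 0 (pi_ge0 _).
- exact: continuous_subspaceT.
- rewrite cos0 sin0 cospi sinpi !mulr0 !addr0 mulr1 mulrN1 ge_min le_max !oppr_cp0.
  by have := le_total 0 a; case: (0 <= a); case: (a <= 0).
set r := Num.sqrt _.
pose rho := b * cos p - a * sin p.
have cs : cos p ^+ 2 + sin p ^+ 2 = 1 by exact: cos2Dsin2.
have gE x : a * cos x + b * sin x = rho * sin (x - p).
  rewrite sinB /rho; apply/eqP; rewrite -subr_eq0; apply/eqP.
  (* The relations [gp] and [cs] enter as explicit multiples, since [ring] treats the sines and
     cosines as independent variables. *)
  transitivity ((a * cos p + b * sin p) * (cos x * cos p + sin x * sin p)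
    + (a * cos x + b * sin x) * (1 - (cos p ^+ 2 + sin p ^+ 2))); last first.
    by rewrite gp cs subrr; ring.
  ring.
have rhor : `|rho| = r.
  rewrite -sqrtr_sqr /r; congr Num.sqrt.
  transitivity ((a ^+ 2 + b ^+ 2) * (cos p ^+ 2 + sin p ^+ 2)
     - (a * cos p + b * sin p) ^+ 2); last by rewrite gp cs; ring.
  by rewrite /rho; ring.
pose F x := r * (cos (Num.min (x - p) 0) - cos (Num.max (x - p) 0)).
exists F, p; split.
- rewrite /F; cont; apply: continuous_comp_real; try exact: continuous_cos.
    by apply: continuous_minr; cont.
  by apply: continuous_maxr; cont.
- rewrite /F sub0r min_r ?subr_ge0// max_l ?subr_ge0// min_l ?oppr_le0//.
  by rewrite max_r ?oppr_le0// cos0 cosN cosB cospi sinpi; ring.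
- move=> x /andP[x0 xpi] xp; rewrite gE normrM rhor.
  have dcos : is_derive x 1 (fun x => cos (x - p)) (- sin (x - p)).
    have -> : (fun x : R => cos (x - p)) = cos \o (fun x => x - p) by [].
    rewrite -[X in is_derive _ _ _ X]mulr1.
    apply: is_derive1_comp; rewrite -[X in is_derive _ _ _ X]subr0.
    by apply: is_deriveB.
  have [xltp|pltx] := ltP x p.
    have -> : `|sin (x - p)| = - sin (x - p).
      rewrite -normrN -sinN opprB ger0_norm // sin_ge0_pi// subr_ge0 ltW//=.
      by rewrite lerBlDr (le_trans ppi)// lerDl ltW.
    apply: (@near_eq_is_derive _ _ _ (fun x => r * (cos (x - p) - cos 0))); last first.
      apply: is_derive_cmul; rewrite -[X in is_derive _ _ _ X]subr0.
      exact: is_deriveB.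
    near=> z; have zp : z < p by near: z; exact: lt_nbhsl.
    by rewrite /F min_l ?max_r ?subr_le0// ltW.
  have {}pltx : p < x by rewrite lt_neqAle eq_sym xp.
  rewrite ger0_norm; last first.
    by rewrite sin_ge0_pi// subr_ge0 (ltW pltx)/= lerBlDr (le_trans (ltW xpi))// lerDl.
  apply: (@near_eq_is_derive _ _ _ (fun x => r * (cos 0 - cos (x - p)))); last first.
    apply: is_derive_cmul; rewrite -(opprK (sin (x - p))) -[X in is_derive _ _ _ X]sub0r.
    exact: is_deriveB.
  near=> z; have zp : p < z by near: z; exact: lt_nbhsr.
  by rewrite /F min_r ?max_l ?subr_ge0// ltW.
Unshelve. all: by end_near. Qed.

(* Cauchy-Crofton: a vector of length [l] has projections of total length
   [2 l] over the directions of a half turn. *)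
Lemma sum_length_le_projections (m : nat) (v w : 'I_m -> R) (B : R) :
  (forall x, \sum_k `|v k * cos x + w k * sin x| <= B) ->
  2 * \sum_k Num.sqrt (v k ^+ 2 + w k ^+ 2) <= pi * B.
Proof.
move=> HB.
have /choice[F /choice[p Fp]] := fun k => primitive_abs_sinusoid (v k) (w k).
pose G x := \sum_k F k x + - B * x.
have : G pi <= G 0.
  apply: (@le_of_derive_le0_finite G 0 pi (range p)).
  - exact: pi_ge0.
  - apply: continuous_add; first by apply: continuous_fsum => k; case: (Fp k).
    by move=> y; apply: cvgM; [exact: cvg_cst | exact: cvg_id].
  - exact: finite_image.
  - move=> x x0pi xp; exists (\sum_k `|v k * cos x + w k * sin x| - B).
      by rewrite subr_le0.
    apply: is_deriveD.
      apply: is_derive_fsum => k; have [_ _ ] := Fp k; apply => //.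
      by apply/eqP => xpk; apply: xp; exists k.
    by rewrite -[X in is_derive _ _ _ X]mulr1; apply: is_derive_cmul; exact: is_derive_id.
rewrite /G mulr0 addr0 -subr_le0 addrAC -sumrB.
under eq_bigr => k _ do (have [_ -> _] := Fp k).
by rewrite -mulr_sumr mulNr subr_le0 mulrC [B * _]mulrC mulrC.
Qed.

End RealAnalysis.

(** * Complex numbers through their real coordinates *)

Section ComplexCoordinates.
Variable R : realType.
Implicit Types x y z w : R[i].

Lemma complex_ext x y : Re x = Re y -> Im x = Im y -> x = y.
Proof. by case: x y => [a b] [c d] /= -> ->. Qed.

Lemma cReD x y : Re (x + y) = Re x + Re y. Proof. by case: x; case: y. Qed.
Lemma cImD x y : Im (x + y) = Im x + Im y. Proof. by case: x; case: y. Qed.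
Lemma cReN x : Re (- x) = - Re x. Proof. by case: x. Qed.
Lemma cImN x : Im (- x) = - Im x. Proof. by case: x. Qed.
Lemma cReM x y : Re (x * y) = Re x * Re y - Im x * Im y.
Proof. by case: x; case: y. Qed.
Lemma cImM x y : Im (x * y) = Re x * Im y + Im x * Re y.
Proof. by case: x; case: y. Qed.
Lemma cReJ x : Re (conjc x) = Re x. Proof. by case: x. Qed.
Lemma cImJ x : Im (conjc x) = - Im x. Proof. by case: x. Qed.
Lemma real_complexM (a b : R) : ((a * b)%:C = a%:C * b%:C)%C.
Proof. exact: rmorphM. Qed.
Lemma Re_real (a : R) : Re (a%:C)%C = a. Proof. by []. Qed.
Lemma Im_real (a : R) : Im (a%:C)%C = 0. Proof. by []. Qed.

Lemma cRe_i : Re ('i%C : R[i]) = 0 :> R. Proof. by []. Qed.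
Lemma cIm_i : Im ('i%C : R[i]) = 1 :> R. Proof. by []. Qed.

Definition ReImE := (cReD, cImD, cReN, cImN, cReM, cImM, cReJ, cImJ, cRe_i, cIm_i,
  Re_real, Im_real).

Definition normsq z : R := Re z ^+ 2 + Im z ^+ 2.

Lemma normsq_ge0 z : 0 <= normsq z.
Proof. by rewrite addr_ge0 ?sqr_ge0. Qed.

Lemma normsq_eq0 z : (normsq z == 0) = (z == 0).
Proof. by rewrite paddr_eq0 ?sqr_ge0// !sqrf_eq0 eq_complex. Qed.

Lemma normsq_gt0 z : (0 < normsq z) = (z != 0).
Proof. by rewrite lt_neqAle normsq_ge0 andbT eq_sym normsq_eq0. Qed.

Lemma normsqM x y : normsq (x * y) = normsq x * normsq y.
Proof. by rewrite /normsq !ReImE; ring. Qed.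

Lemma normsqN x : normsq (- x) = normsq x.
Proof. by rewrite /normsq !ReImE; ring. Qed.

Lemma mulc_conj z : z * conjc z = ((normsq z)%:C)%C.
Proof. by apply: complex_ext; rewrite /normsq !ReImE; ring. Qed.

Lemma normcE_sq z : normc z = Num.sqrt (normsq z).
Proof. by case: z. Qed.

(* [z + |z|] is, up to a positive factor, a square root of [z], continuous on
   the plane slit along the negative reals. *)
Definition slit_sqrt z : R[i] := z + ((Num.sqrt (normsq z))%:C)%C.

Lemma slit_sqrt_sq z :
  slit_sqrt z ^+ 2 = ((2 * (Re z + Num.sqrt (normsq z)))%:C)%C * z.
Proof.
have rr : Num.sqrt (normsq z) ^+ 2 = normsq z by rewrite sqr_sqrtr ?normsq_ge0.
rewrite /slit_sqrt expr2; set r := Num.sqrt _ in rr *; rewrite /normsq in rr.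
apply: complex_ext; rewrite !ReImE; last by ring.
transitivity (Re z ^+ 2 - Im z ^+ 2 + 2 * Re z * r + r ^+ 2); first by ring.
by rewrite rr; ring.
Qed.

(** The hypothesis says that [z] is off the slit; this makes the factor in [slit_sqrt_sq]
    positive. *)
Lemma slit_gt0 z : (0 < Re z) || (Im z != 0) -> 0 < Re z + Num.sqrt (normsq z).
Proof.
move=> h; suff : `|Re z| < Num.sqrt (normsq z) \/ 0 < Re z.
  case=> [|z0]; last by rewrite ltr_pwDl// sqrtr_ge0.
  by rewrite -subr_gt0 => k; apply: (lt_le_trans k);
    rewrite addrC lerD2r lerNl -normrN ler_norm.
case/orP: h => h; [by right|left].
by rewrite -sqrtr_sqr ltr_sqrt ?ltrDl ?exprn_even_gt0// normsq_gt0; case: (z) h => a b /=;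
  rewrite eq_complex/= => /negbTE ->; rewrite andbF.
Qed.

(** Coordinatewise, so that only the topology of the target [R] is involved. *)
Definition ccontinuous (T : topologicalType) (c : T -> R[i]) :=
  continuous (fun t => Re (c t)) /\ continuous (fun t => Im (c t)).

Section CContinuity.
Variable T : topologicalType.
Implicit Types f g : T -> R[i].

Lemma ccontinuousD f g : ccontinuous f -> ccontinuous g ->
  ccontinuous (fun t => f t + g t).
Proof.
move=> [f1 f2] [g1 g2]; split.
  by apply: (continuous_ext (fun t => esym (cReD (f t) (g t)))); cont.
by apply: (continuous_ext (fun t => esym (cImD (f t) (g t)))); cont.
Qed.

Lemma ccontinuousN f : ccontinuous f -> ccontinuous (fun t => - f t).
Proof.
move=> [f1 f2]; split.
  by apply: (continuous_ext (fun t => esym (cReN (f t)))); cont.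
by apply: (continuous_ext (fun t => esym (cImN (f t)))); cont.
Qed.

Lemma ccontinuousM f g : ccontinuous f -> ccontinuous g ->
  ccontinuous (fun t => f t * g t).
Proof.
move=> [f1 f2] [g1 g2]; split.
  by apply: (continuous_ext (fun t => esym (cReM (f t) (g t)))); cont.
by apply: (continuous_ext (fun t => esym (cImM (f t) (g t)))); cont.
Qed.

Lemma ccontinuousJ f : ccontinuous f -> ccontinuous (fun t => conjc (f t)).
Proof.
move=> [f1 f2]; split.
  by apply: (continuous_ext (fun t => esym (cReJ (f t)))); cont.
by apply: (continuous_ext (fun t => esym (cImJ (f t)))); cont.
Qed.

Lemma ccontinuous_cst z : ccontinuous (fun _ : T => z).
Proof. by split; cont. Qed.

Lemma ccontinuous_real (f : T -> R) :
  continuous f -> ccontinuous (fun t => ((f t)%:C)%C).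
Proof. by move=> cf; split; [exact: cf | move=> ?; exact: cvg_cst]. Qed.

Lemma continuous_normsq f : ccontinuous f -> continuous (fun t => normsq (f t)).
Proof. by move=> [f1 f2]; rewrite /normsq; cont. Qed.

Lemma ccontinuous_slit f : ccontinuous f -> ccontinuous (fun t => slit_sqrt (f t)).
Proof.
move=> cf; apply: ccontinuousD => //; apply: ccontinuous_real.
apply: continuous_comp_real; first exact: sqrt_continuous.
exact: continuous_normsq.
Qed.

End CContinuity.

Lemma ccontinuous_comp (c : R -> R[i]) (h : R -> R) :
  continuous h -> ccontinuous c -> ccontinuous (fun t => c (h t)).
Proof.
by move=> ch [c1 c2]; split => t;
  [exact: (continuous_comp (ch t) (c1 _)) | exact: (continuous_comp (ch t) (c2 _))].
Qed.

End ComplexCoordinates.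

Ltac ccont := try assumption; try match goal with
  | |- ccontinuous (fun=> ?z) => exact: ccontinuous_cst
  | |- ccontinuous (fun x => @?f x + @?g x) => apply: (@ccontinuousD _ _ f g); ccont
  | |- ccontinuous (fun x => - @?f x) => apply: (@ccontinuousN _ _ f); ccont
  | |- ccontinuous (fun x => @?f x * @?g x) => apply: (@ccontinuousM _ _ f g); ccont
  | |- ccontinuous (fun x => conjc (@?f x)) => apply: (@ccontinuousJ _ _ f); ccont
  | |- ccontinuous (fun x => slit_sqrt (@?f x)) =>
      apply: (@ccontinuous_slit _ _ f); ccont
  | |- ccontinuous (fun x => ((@?f x)%:C)%C) =>
      apply: (@ccontinuous_real _ _ f); cont
  end.

(** * Winding numbers modulo 2 by continuous square roots *)

Section SquareRootLifts.
Variable R : realType.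
Implicit Types (c s : R -> R[i]) (z w : R[i]) (a b r t : R).

Definition sqrt_lift c z a b s := ccontinuous s /\
  forall t, a <= t <= b -> exists2 r, 0 < r & s t ^+ 2 = (r%:C)%C * (c t - z).

Lemma continuous_same_sign (f : R -> R) a b : a <= b -> continuous f ->
  (forall t, a <= t <= b -> f t != 0) -> 0 < f a * f b.
Proof.
move=> ab cf f0; rewrite ltNge; apply/negP => ffle0.
have h0 : Num.min (f a) (f b) <= 0 <= Num.max (f a) (f b).
  rewrite ge_min le_max; have := f0 a; have := f0 b;
    rewrite !lexx ab => /(_ isT) fb /(_ isT) fa.
  have [fa0|fa0] := ltrP 0 (f a).
    by rewrite (ltW fa0) andbT; apply/orP; right; rewrite -(pmulr_rle0 _ fa0).
  rewrite /=; apply/orP; right; have {}fa0 : f a < 0 by rewrite lt_neqAle fa.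
  by rewrite -(nmulr_rle0 _ fa0).
have [t] := IVT ab (continuous_subspaceT cf) h0.
by rewrite in_itv/= => tab; apply/eqP/f0.
Qed.

Lemma sqr_gt0_real w r : 0 < r -> w ^+ 2 = (r%:C)%C -> Im w = 0 /\ Re w != 0.
Proof.
move=> r0 e.
have := congr1 (@complex.Re R) e; have := congr1 (@complex.Im R) e.
rewrite expr2 !ReImE => e2 e1.
have rw : Re w != 0.
  by apply/eqP => rw; move: e1; rewrite rw; have := sqr_ge0 (Im w); rewrite expr2; lra.
split=> //; apply/eqP; move/eqP: e2; rewrite mulrC -mulr2n mulrn_eq0/= mulf_eq0.
by rewrite (negbTE rw) orbF.
Qed.

(** A number with positive square is real and nonzero, so the intermediate value theorem applies to
    the real part. This is how a parity obstruction is detected in [not_even_across_chord]. *)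
Lemma same_sign_of_sqr_gt0 (f : R -> R[i]) a b : a <= b -> ccontinuous f ->
  (forall t, a <= t <= b -> exists2 r, 0 < r & f t ^+ 2 = (r%:C)%C) ->
  [/\ Im (f a) = 0, Im (f b) = 0 & 0 < Re (f a) * Re (f b)].
Proof.
move=> ab [cf _] f2.
have f2' t : a <= t <= b -> Im (f t) = 0 /\ Re (f t) != 0.
  by move=> /f2[r r0 /(sqr_gt0_real r0)].
split; [| |apply: (@continuous_same_sign (fun t => Re (f t))) => // t /f2'[]//].
  by have [|] := f2' a; rewrite ?lexx ?ab.
by have [|] := f2' b; rewrite ?lexx ?ab.
Qed.

(** The lift at [z] is multiplied by a root of [(c t - z') / (c t - z)]. Up to a positive factor
    this quotient is [(c t - z') * conjc (c t - z)], whose real part is positive by the polarization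
    identity when [z'] is closer to [z] than [c t] is. *)
Lemma sqrt_lift_near c z z' a b s : ccontinuous c ->
  (forall t, a <= t <= b -> normsq (z' - z) < normsq (c t - z)) ->
  sqrt_lift c z a b s ->
  sqrt_lift c z' a b (fun t => s t * slit_sqrt ((c t - z') * conjc (c t - z))).
Proof.
move=> cc near_z [cs s2]; split; first by ccont.
move=> t tab; have [r r0 e] := s2 t tab; have := near_z t tab.
set u := (c t - z') * _ => zt.
have u0 : 0 < Re u.
  have -> : Re u = (normsq (c t - z) - normsq (z' - z) + normsq (c t - z')) / 2.
    by rewrite /u /normsq !ReImE; field.
  by rewrite divr_gt0// ltr_wpDr ?normsq_ge0// subr_gt0.
have zt0 : 0 < normsq (c t - z) by rewrite (le_lt_trans _ zt) ?normsq_ge0.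
exists (r * (2 * (Re u + Num.sqrt (normsq u))) * normsq (c t - z)).
  by rewrite !mulr_gt0//; apply: slit_gt0; rewrite u0.
rewrite exprMn e slit_sqrt_sq !rmorphM/= /u.
set k := Num.sqrt _; rewrite -mulc_conj.
by rewrite !rmorphD/= ?rmorphM/=; ring.
Qed.

(** In the half-plane the product [conjc e * (c t - z)] stays off the slit; the root [k] of [e]
    undoes the rotation by [conjc e]. *)
Lemma sqrt_lift_halfplane c z e a b (k : R[i]) : ccontinuous c -> k ^+ 2 = e ->
  (forall t, a <= t <= b -> 0 < Re (conjc e * (c t - z))) ->
  sqrt_lift c z a b (fun t => k * slit_sqrt (conjc e * (c t - z))).
Proof.
move=> cc ke he; split; first by ccont.
move=> t /he ht; have u0 := slit_gt0 (introT orP (or_introl ht)).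
have e0 : 0 < normsq e.
  by rewrite normsq_gt0; apply/eqP => e0; move: ht; rewrite e0 conjc0 mul0r ltxx.
exists (2 * (Re (conjc e * (c t - z)) + Num.sqrt (normsq (conjc e * (c t - z)))) * normsq
  e).
  by rewrite !mulr_gt0.
rewrite exprMn ke slit_sqrt_sq.
set q := 2 * _; rewrite [in RHS]rmorphM/= -mulc_conj; ring.
Qed.

End SquareRootLifts.

(* Points with even winding number with respect to the closed curve made of
   the arc [c] on [[t1, t2]] and the chord from [c t1] to [c t2]: the function
   [w - z] has a continuous square root (up to positive factors) on it. *)
Section ClosedCurve.
Variables (R : realType) (c : R -> R[i]) (t1 t2 : R).
Hypotheses (cc : ccontinuous c) (t12 : t1 <= t2).
Implicit Types (z w e : R[i]).

Definition chord (s : R) : R[i] := c t1 + (s%:C)%C * (c t2 - c t1).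

Lemma ccontinuous_chord : ccontinuous chord.
Proof. by rewrite /chord; ccont. Qed.

Definition off_curve z := (forall t, t1 <= t <= t2 -> c t != z) /\
  (forall s, 0 <= s <= 1 -> chord s != z).

Definition even_point z := exists s1 s2, [/\ sqrt_lift c z t1 t2 s1,
  sqrt_lift chord z 0 1 s2, s1 t1 = s2 0 & s1 t2 = s2 1].

Lemma chord0 : chord 0 = c t1.
Proof. by rewrite /chord rmorph0 mul0r addr0. Qed.

Lemma chord1 : chord 1 = c t2.
Proof. by rewrite /chord rmorph1 mul1r addrC subrK. Qed.

Lemma even_point_near z z' :
  (forall t, t1 <= t <= t2 -> normsq (z' - z) < normsq (c t - z)) ->
  (forall s, 0 <= s <= 1 -> normsq (z' - z) < normsq (chord s - z)) ->
  even_point z -> even_point z'.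
Proof.
move=> h1 h2 [s1 [s2 [l1 l2 e1 e2]]].
exists (fun t => s1 t * slit_sqrt ((c t - z') * conjc (c t - z))).
exists (fun t => s2 t * slit_sqrt ((chord t - z') * conjc (chord t - z))).
split; rewrite ?chord0 ?chord1 ?e1 ?e2//.
  exact: sqrt_lift_near.
by apply: sqrt_lift_near => //; exact: ccontinuous_chord.
Qed.

Lemma chord_halfplane z e :
  (forall t, t1 <= t <= t2 -> 0 < Re (conjc e * (c t - z))) ->
  forall s, 0 <= s <= 1 -> 0 < Re (conjc e * (chord s - z)).
Proof.
move=> h s /andP[s0 s1].
have := h t1; have := h t2; rewrite !lexx t12 => /(_ isT) h2 /(_ isT) h1.
have -> : Re (conjc e * (chord s - z)) = (1 - s) * Re (conjc e * (c t1 - z)) +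
    s * Re (conjc e * (c t2 - z)) by rewrite /chord !ReImE; ring.
move: h1 h2; set x := Re _; set y := Re _ => x0 y0; clear -x0 y0 s0 s1.
have [->|s00] := eqVneq s 0; first by lra.
by rewrite ltr_wpDl ?mulr_ge0 ?mulr_gt0 ?(ltW x0) ?subr_ge0// lt_neqAle eq_sym s00.
Qed.

Lemma off_curve_halfplane z e :
  (forall t, t1 <= t <= t2 -> 0 < Re (conjc e * (c t - z))) -> off_curve z.
Proof.
move=> h; split=> [t /h|s /(chord_halfplane h)] e0; apply/eqP => ez; move: e0.
  by rewrite ez subrr mulr0 ltxx.
by rewrite ez subrr mulr0 ltxx.
Qed.

Lemma even_point_halfplane z e :
  (forall t, t1 <= t <= t2 -> 0 < Re (conjc e * (c t - z))) -> even_point z.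
Proof.
move=> h; have h' := chord_halfplane h.
exists (fun t => sqrtc e * slit_sqrt (conjc e * (c t - z))).
exists (fun t => sqrtc e * slit_sqrt (conjc e * (chord t - z))).
split; rewrite ?chord0 ?chord1//; apply: sqrt_lift_halfplane; rewrite ?sqr_sqrtc//.
exact: ccontinuous_chord.
Qed.

Lemma arc_distance (f : R -> R[i]) a b z : a <= b -> ccontinuous f ->
  (forall t, a <= t <= b -> f t != z) ->
  exists2 d : R, 0 < d & forall t, a <= t <= b -> d <= normsq (f t - z).
Proof.
move=> ab cf fz.
have cn : continuous (fun t => normsq (f t - z)).
  by apply: continuous_normsq; ccont.
have [t tab tmin] := EVT_min ab (continuous_subspaceT cn).
rewrite in_itv/= in tab.
exists (normsq (f t - z)); first by rewrite normsq_gt0 subr_eq0 fz.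
by move=> u uab; apply: tmin; rewrite in_itv.
Qed.

Lemma off_curve_ball z : off_curve z -> exists2 d : R, 0 < d &
  forall z', normsq (z' - z) < d ->
    off_curve z' /\ (even_point z <-> even_point z').
Proof.
move=> [z1 z2].
have [d1 d10 zd1] := arc_distance t12 cc z1.
have [d2 d20 zd2] := arc_distance ler01 ccontinuous_chord z2.
pose d := Num.min d1 d2; have d0 : 0 < d by rewrite lt_min d10.
have dd1 : d <= d1 by rewrite ge_min lexx.
have dd2 : d <= d2 by rewrite ge_min lexx orbT.
(* A quarter for squared distances is a half for distances. The second inequality allows [z] and
   [z'] to exchange roles, which gives the converse implication between their parities. *)
have tri z' w : normsq (z' - z) < d / 4 -> d <= normsq (w - z) ->
    normsq (z' - z) < normsq (w - z) /\ normsq (z' - z) < normsq (w - z').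
  move=> zd wd; split; first by clear -zd wd d0; lra.
  have := normsq_ge0 ((w - z') - (z' - z)).
  have -> : normsq (w - z' - (z' - z)) =
      2 * normsq (w - z') + 2 * normsq (z' - z) - normsq (w - z).
    by rewrite /normsq !ReImE; ring.
  by clear -d0 zd wd; lra.
have zz' z' : normsq (z' - z) = normsq (z - z') by rewrite -normsqN opprB.
exists (d / 4); first by rewrite divr_gt0.
move=> z' zd; split; [split|split].
- move=> t tab; have [] := tri _ (c t) zd; first by rewrite (le_trans dd1)// zd1.
  by move=> _; rewrite -subr_eq0 -normsq_gt0; apply: le_lt_trans; exact: normsq_ge0.
- move=> t tab; have [] := tri _ (chord t) zd; first by rewrite (le_trans dd2)// zd2.
  by move=> _; rewrite -subr_eq0 -normsq_gt0; apply: le_lt_trans; exact: normsq_ge0.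
- apply: even_point_near => t tab.
    by have [] := tri _ (c t) zd; first by rewrite (le_trans dd1)// zd1.
  by have [] := tri _ (chord t) zd; first by rewrite (le_trans dd2)// zd2.
- apply: even_point_near => t tab; rewrite -zz'.
    by have [] := tri _ (c t) zd; first by rewrite (le_trans dd1)// zd1.
  by have [] := tri _ (chord t) zd; first by rewrite (le_trans dd2)// zd2.
Qed.

(** Parity is locally constant off the curve, so its indicator [chi] along the path is continuous;
    with values in 0 and 1 it cannot reach 1/2. *)
Lemma even_point_path (p : R -> R[i]) a b : a <= b -> ccontinuous p ->
  (forall t, a <= t <= b -> off_curve (p t)) ->
  even_point (p a) -> even_point (p b).
Proof.
move=> ab cp offp pa; apply: contrapT => pb.
pose h (t : R) := Num.max a (Num.min t b).
have hab t : a <= h t <= b by rewrite /h le_max ge_max lexx ab/= ge_min lexx orbT.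
have h_id t : a <= t <= b -> h t = t.
  by move=> /andP[at_ tb]; rewrite /h min_l// max_r.
pose chi (t : R) : R := if pselect (even_point (p (h t))) then 0 else 1.
have cchi : continuous chi.
  move=> t; have [d d0 pd] := off_curve_ball (offp _ (hab t)).
  have ch := @continuous_clamp R a b.
  have cn : continuous (fun u => normsq (p (h u) - p (h t))).
    apply: continuous_normsq; apply: (@ccontinuousD _ _ (fun u => p (h u)));
      last exact: ccontinuous_cst.
    exact: ccontinuous_comp.
  suff : \forall u \near t, chi u = chi t.
    exact: cvg_near_cst.
  have : \forall u \near t, normsq (p (h u) - p (h t)) < d.
    apply: (cvgr_lt (normsq (p (h t) - p (h t))) (cn t)).
    by rewrite subrr /normsq /= expr0n addr0.
  apply: filterS => u /pd[_ [e1 e2]]; rewrite /chi.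
  by case: pselect => k1; case: pselect => k2 //; exfalso; tauto.
have chia : chi a = 0.
  by rewrite /chi; case: pselect => //; rewrite h_id// lexx.
have chib : chi b = 1.
  by rewrite /chi; case: pselect => //; rewrite h_id// lexx ab.
have chi_half : Num.min (chi a) (chi b) <= 1 / 2 <= Num.max (chi a) (chi b).
  by rewrite chia chib ge_min le_max; apply/andP; split; apply/orP; [left|right]; lra.
have [t _] := IVT ab (continuous_subspaceT cchi) chi_half.
by rewrite /chi; case: pselect => ? /=; lra.
Qed.

Lemma even_point_segment z z' :
  (forall s : R, 0 <= s <= 1 -> off_curve (z + (s%:C)%C * (z' - z))) ->
  even_point z -> even_point z'.
Proof.
move=> offz.
have cp : ccontinuous (fun s : R => z + (s%:C)%C * (z' - z)) by ccont.
have := even_point_path ler01 cp offz.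
by rewrite rmorph0 rmorph1 mul0r mul1r addr0 addrC subrK.
Qed.

(* Crossing the chord changes the parity: otherwise the square root lifts at
   [m + i e] and [m - i e] would combine into one of
   [(w - m - i e) / (w - m + i e)], whose argument turns once along the curve. *)
Lemma not_even_across_chord (x y e : R) :
  Im (c t1) = y -> Im (c t2) = y ->
  (x - Re (c t1)) * (Re (c t2) - x) > 0 -> 0 < e ->
  (forall t, t1 <= t <= t2 -> Re (c t) = x -> e ^+ 2 < (Im (c t) - y) ^+ 2) ->
  even_point (x +i* (y + e))%C -> even_point (x +i* (y - e))%C -> False.
Proof.
move=> yt1 yt2 xbetween e0 avoid [s1 [s2 [[cs1 s1P] [cs2 s2P] s12 s12']]].
move=> [r1 [r2 [[cr1 r1P] [cr2 r2P] r12 r12']]].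
set zp := (x +i* (y + e))%C in s1P s2P; set zm := (x +i* (y - e))%C in r1P r2P.
(* On both pieces the lifts at [zp] and [zm] are combined with a root of [(w - zm) / (w - zp)], up
   to positive factors, so [f1] and [f2] have positive squares and keep their signs. The arc avoids
   the segment from [zm] to [zp], where [slit_sqrt] breaks down. The chord crosses it, but there
   [w - zp] is the conjugate of [w - zm], and [w - zm] itself is such a root. *)
pose f1 t := s1 t * conjc (r1 t) * conjc (slit_sqrt ((c t - zp) * conjc (c t - zm))).
pose f2 s := s2 s * conjc (r2 s) * (chord s - zm).
have conj_sq (w : R[i]) (r : R) v : w ^+ 2 = (r%:C)%C * v ->
  conjc w ^+ 2 = (r%:C)%C * conjc v.
  move=> e'; transitivity (conjc (w ^+ 2)); first by rewrite rmorphXn.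
  by rewrite e' rmorphM/=; congr (_ * _); exact: conjc_real.
have cf1 : ccontinuous f1 by rewrite /f1; ccont.
have f1sq t : t1 <= t <= t2 -> exists2 r, 0 < r & f1 t ^+ 2 = (r%:C)%C.
  move=> tt; have [r r0 e1] := s1P t tt; have [r' r'0 e2] := r1P t tt.
  have {}e2 := conj_sq _ _ _ e2.
  set u := (c t - zp) * conjc (c t - zm).
  have u0 : (0 < Re u) || (Im u != 0).
    have [rx|rx] := eqVneq (Re (c t)) x.
      apply/orP; left; rewrite /u !ReImE /= rx.
      by have := avoid t tt rx; rewrite !expr2; lra.
    apply/orP; right; rewrite /u !ReImE /=.
    rewrite (_ : _ + _ = - 2 * e * (Re (c t) - x)); last by ring.
    by rewrite !mulf_eq0 !negb_or oppr_eq0 pnatr_eq0 (gt_eqF e0) subr_eq0 rx.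
  have su := slit_gt0 u0; exists (r * r' * (2 * (Re u + Num.sqrt (normsq u))) * normsq u).
    rewrite !mulr_gt0// normsq_gt0; apply/eqP => u00.
    by move: u0; rewrite u00 /= ltxx eqxx.
  rewrite /f1 -/u exprMn exprMn e1 e2 (conj_sq _ _ _ (slit_sqrt_sq u)).
  rewrite !real_complexM -mulc_conj [in RHS](_ : u * _ = (c t - zp) * conjc (c t - zm) *
    conjc u)//.
  by set v := conjc u; ring.
have [_ _ f1s] := same_sign_of_sqr_gt0 t12 cf1 f1sq.
have zE w : Im w = y -> w - zp = conjc (w - zm).
  by move=> wy; apply: complex_ext; rewrite !ReImE /zp /zm /= ?wy; ring.
have n0 w : Im w = y -> 0 < normsq (w - zm).
  move=> wy; rewrite normsq_gt0; apply/eqP => /(congr1 (@complex.Im R)).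
  by rewrite !ReImE wy /zm /=; lra.
have cf2 : ccontinuous f2.
  by have cch := ccontinuous_chord; rewrite /f2; ccont.
have f2sq s : 0 <= s <= 1 -> exists2 r, 0 < r & f2 s ^+ 2 = (r%:C)%C.
  move=> ss; have [r r0 e1] := s2P s ss; have [r' r'0 e2] := r2P s ss.
  have {}e2 := conj_sq _ _ _ e2.
  have yc : Im (chord s) = y by rewrite /chord !ReImE yt1 yt2; ring.
  have n0s := n0 _ yc.
  exists (r * r' * normsq (chord s - zm) ^+ 2); first by rewrite !mulr_gt0.
  rewrite /f2 !exprMn e1 e2 (zE _ yc) expr2 !real_complexM -mulc_conj.
  by ring.
have [_ _ f2s] := same_sign_of_sqr_gt0 ler01 cf2 f2sq.
(* At height [y] the two roots differ by the real factor [2 * (Re w - x)], which has opposite signs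
   at the two ends of the chord: [f1] and [f2] cannot both keep their signs. *)
have slitE t : Im (c t) = y ->
    conjc (slit_sqrt ((c t - zp) * conjc (c t - zm))) =
    ((2 * (Re (c t) - x))%:C)%C * (c t - zm).
  move=> yc; rewrite /slit_sqrt.
  have -> : normsq ((c t - zp) * conjc (c t - zm)) = ((Re (c t) - x) ^+ 2 + e ^+ 2) ^+ 2.
    by rewrite normsqM /normsq !ReImE /= yc; ring.
  rewrite sqrtr_sqr ger0_norm ?addr_ge0 ?sqr_ge0//.
  by apply: complex_ext; rewrite !ReImE /= yc; ring.
have E1 : f1 t1 = ((2 * (Re (c t1) - x))%:C)%C * f2 0.
  by rewrite /f1 /f2 slitE// s12 r12 chord0; ring.
have E2 : f1 t2 = ((2 * (Re (c t2) - x))%:C)%C * f2 1.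
  by rewrite /f1 /f2 slitE// s12' r12' chord1; ring.
move: f1s; rewrite E1 E2; move: (f2 0) (f2 1) f2s => F0 F1 f2s.
rewrite !ReImE !mul0r !subr0.
rewrite mulrACA (pmulr_lgt0 _ f2s) (_ : _ * _ = - (4 * ((x - Re (c t1)) * (Re (c t2) -
  x)))); last by ring.
by rewrite oppr_gt0 ltNge mulr_ge0// ltW.
Qed.

End ClosedCurve.

(** * Local growth and the maximum principle for polynomials *)

Section Preliminaries.
Variable R : realType.

Lemma is_derive_gt0_local (h : R -> R) (t d : R) : is_derive t 1 h d -> 0 < d ->
  exists2 e, 0 < e & forall u, (t < u < t + e -> h t < h u) /\
    (t - e < u < t -> h u < h t).
Proof.
move=> [dh hd] d0.
have : (fun k : R => k^-1 *: (h (k *: 1 + t) - h t)) @ 0^' --> d.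
  by rewrite -hd; exact: dh.
move=> /cvgr_gt /(_ 0 d0)[e /= e0 he].
exists e => // u; split=> /andP[u1 u2].
  have ut : 0 < u - t by rewrite subr_gt0.
  have := he (u - t); rewrite /ball_/= sub0r normrN gtr0_norm// => /(_ _ _).
  rewrite ltrBlDl u2 gt_eqF// => /(_ isT isT).
  by rewrite /GRing.scale/= mulr1 subrK pmulr_rgt0 ?invr_gt0// subr_gt0.
have ut : u - t < 0 by rewrite subr_lt0.
have := he (u - t); rewrite /ball_/= sub0r normrN ltr0_norm// => /(_ _ _).
rewrite opprB ltrBlDr -ltrBlDl u1 lt_eqF// => /(_ isT isT).
by rewrite /GRing.scale/= mulr1 subrK nmulr_rgt0 ?invr_lt0// subr_lt0.
Qed.

Lemma is_derive_prod_exp (I : Type) (r : seq I) (n : I -> nat)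
    (F : I -> R -> R) (dF : I -> R) (x : R) :
  (forall i, F i x != 0) -> (forall i, is_derive x 1 (F i) (dF i)) ->
  is_derive x 1 (fun y => \prod_(i <- r) F i y ^+ n i)
    (\prod_(i <- r) F i x ^+ n i * \sum_(i <- r) (n i)%:R * (dF i / F i x)).
Proof.
move=> F0 dFi; elim: r => [|i r IH].
  rewrite !big_nil mulr0; under eq_fun do rewrite big_nil; exact: is_derive_cst.
rewrite !big_cons; under eq_fun do rewrite big_cons.
have dX : is_derive x 1 (fun y => F i y ^+ n i)
    ((n i)%:R * F i x ^+ (n i).-1 * dF i).
  have -> : (fun y => F i y ^+ n i) = F i ^+ n i.
    by apply/funext => y; rewrite exprfctE.
  exact: is_deriveX.
apply: (is_derive_eq (is_deriveM dX IH)).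
rewrite /GRing.scale/=; have := F0 i.
case: (n i) => [|m]; first by rewrite !mul0r mulr0 addr0 add0r !expr0 !mul1r.
by rewrite [_.+1.-1]/= exprS => Fi0; field.
Qed.

(** With [a * h ^+ k] the first nonconstant term at [z], [h] is chosen so that this term is aligned
    with the value [c0], and so small that the remainder cannot undo the gain. *)
Lemma exists_larger_modulus (F : numClosedFieldType) (p : {poly F}) (z e : F) :
  (1 < size p)%N -> 0 < e -> exists2 w, `|w - z| < e & `|p.[z]| < `|p.[w]|.
Proof.
move=> p1 e0; pose q := p \Po ('X + z%:P).
have qE h : q.[h] = p.[z + h] by rewrite horner_comp !hornerE addrC.
have sq : size q = size p by rewrite size_comp_poly2 // size_XaddC.
pose c0 := p.[z].
have q0 : q - c0%:P != 0.
  apply/eqP => /eqP; rewrite subr_eq0 => /eqP qc.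
  by move: p1; rewrite -sq qc size_polyC; case: (_ != _).
have rq : root (q - c0%:P) 0 by rewrite /root !hornerE qE addr0 subrr.
have [k [r r0 qr]] := multiplicity_XsubC (q - c0%:P) 0.
rewrite q0 /= in r0; rewrite subr0 in qr.
have k0 : (0 < k)%N.
  by case: k qr => // qr; move: rq; rewrite qr expr0 mulr1 (negbTE r0).
pose a := r.[0].
have a0 : a != 0 by rewrite /a -rootE.
have [r1 rE] : exists r1, r = r1 * 'X + a%:P.
  have : root (r - a%:P) 0 by rewrite /root !hornerE subrr.
  by move=> /factor_theorem[r1 e1]; exists r1; rewrite subr0 in e1; rewrite -e1 subrK.
have qhE h : q.[h] = c0 + (a * h ^+ k + h ^+ k.+1 * r1.[h]).
  by rewrite -[q](subrK c0%:P) qr rE !(hornerD, hornerM, hornerC, hornerX,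
    hornerXn) exprS; ring.
(* When [p] vanishes at [z] there is nothing to align with, and any nonzero target will do. *)
pose d := if c0 == 0 then a else c0.
have d0 : d != 0 by rewrite /d; case: ifP => // ->.
have d_gt0 : 0 < `|d| by rewrite normr_gt0.
pose w := k.-root (d / a).
have wk : a * w ^+ k = d by rewrite rootCK// mulrC divfK.
(* Bounds the remainder at [x * w] by [x ^+ k.+1 * B] for [0 < x <= 1]. *)
pose B := `|w| ^+ k.+1 * \sum_(i < size r1) `|r1`_i| * `|w| ^+ i.
have B0 : 0 <= B.
  by rewrite mulr_ge0 ?exprn_ge0// sumr_ge0// => i _; rewrite mulr_ge0 ?exprn_ge0.
(* The three summands make [x = D^-1] satisfy [x <= 1], [x * B < |d|] and [x * |w| < e]. *)
pose D := 1 + (1 + B / `|d| + `|w| / e).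
have D1 : 1 < D.
  by rewrite ltrDl -addrA ltr_wpDr// addr_ge0// divr_ge0// ltW.
have D0 : 0 < D by rewrite (lt_trans ltr01).
pose x := D^-1; have x0 : 0 < x by rewrite invr_gt0.
have x1 : x <= 1 by rewrite invf_le1// ltW.
have hn : `|x * w| = x * `|w| by rewrite normrM gtr0_norm.
have small_w : x * `|w| < e.
  rewrite mulrC ltr_pdivrMr// -ltr_pdivrMl// mulrC /D addrA ltr_pwDl//.
  by rewrite addr_gt0// ltr_wpDr// divr_ge0// ltW.
have small_B : x * B < `|d|.
  rewrite mulrC ltr_pdivrMr// -ltr_pdivrMl// mulrC -subr_gt0.
  rewrite (_ : _ - _ = 1 + (1 + `|w| / e)); last by rewrite /D; ring.
  by rewrite addr_gt0// ltr_wpDr// divr_ge0// ltW.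
exists (z + x * w); first by rewrite addrAC subrr add0r hn.
rewrite -qE qhE exprMn mulrCA wk addrA.
have n1 : `|c0 + x ^+ k * d| = `|c0| + x ^+ k * `|d|.
  rewrite /d; case: eqVneq => [->|c00].
    by rewrite !normr0 !add0r normrM normrX gtr0_norm.
  rewrite -[X in X + _]mul1r -mulrDl normrM ger0_norm ?mulrDl ?mul1r//.
  by rewrite addr_ge0 ?exprn_ge0// ltW.
have n2 : `|(x * w) ^+ k.+1 * r1.[x * w]| <= x ^+ k * (x * B).
  rewrite normrM normrX hn exprMn /B !mulrA -exprSr ler_wpM2l//.
    by rewrite mulr_ge0 ?exprn_ge0// ltW.
  rewrite horner_coef; apply: le_trans (ler_norm_sum _ _ _) _.
  apply: ler_sum => i _; rewrite normrM normrX hn ler_wpM2l// exprMn.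
  by rewrite ler_piMl ?exprn_ge0// exprn_ile1// ltW.
apply: lt_le_trans (lerB_normD _ _); rewrite n1 -/c0.
rewrite -addrA ltrDl subr_gt0; apply: le_lt_trans n2 _.
by rewrite ltr_pM2l// exprn_gt0.
Qed.


Lemma normC_normsq (w : R[i]) : `|w| = ((Num.sqrt (normsq w))%:C)%C.
Proof. by rewrite normc_def. Qed.

Lemma exists_larger_normsq (p : {poly R[i]}) (z : R[i]) (d : R) :
  (1 < size p)%N -> 0 < d ->
  exists2 w, normsq (w - z) < d & normsq p.[z] < normsq p.[w].
Proof.
move=> p1 d0; have e0 : 0 < ((Num.sqrt d)%:C)%C :> R[i] by rewrite ltcR sqrtr_gt0.
have [w] := exists_larger_modulus z p1 e0.
rewrite !normC_normsq !ltcR ltr_sqrt// => h1 h2; exists w => //.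
rewrite -ltr_sqrt// normsq_gt0; apply: contraTneq h2 => ->.
by rewrite /normsq /= !expr0n addr0 sqrtr0 -leNgt sqrtr_ge0.
Qed.

End Preliminaries.

(* The abscissa normalized to be 0 at [p] and 1 at [q], so that the order of
   these two points on their horizontal line does not matter. *)
Definition abscissa (R : realType) (p q z : R[i]) : R :=
  (Re z - Re p) / (Re q - Re p).

(* A rectangle lying above ([e = 1]) or below ([e = -1]) the height [y]. *)
Definition strip (R : realType) (p q : R[i]) (y m m' d e : R) (z : R[i]) :=
  m - d < abscissa p q z < m' + d /\ 0 < e * (Im z - y) < d.

(** * Parity of the points just below the chord *)

Section BelowChord.
Variables (R : realType) (c : R -> R[i]) (t1 t2 b y eta : R).
Hypotheses (cc : ccontinuous c) (t12 : t1 < t2) (t2b : t2 < b).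
Hypothesis c_inj : forall t u : R, t1 <= t <= b -> t1 <= u <= b -> c t = c u -> t = u.
Hypothesis chord_free : forall t s : R, t1 <= t <= b -> 0 < s < 1 -> c t <> chord c t1 t2 s.
Hypotheses (yt1 : Im (c t1) = y) (yt2 : Im (c t2) = y).
Hypothesis eta0 : 0 < eta.
Hypothesis after_t1 : forall t : R, t1 < t < t1 + eta -> y < Im (c t).
Hypothesis before_t2 : forall t : R, t2 - eta < t < t2 -> Im (c t) < y.
Hypothesis after_t2 : forall t : R, t2 < t < t2 + eta -> y < Im (c t).
Hypothesis even_b : even_point c t1 t2 (c b).

Local Notation L := (Re (c t2) - Re (c t1)).

Let L0 : L != 0.
Proof.
rewrite subr_eq0; apply/eqP => e.
have : t1 = t2.
  by apply: c_inj; rewrite ?lexx ?(ltW t12) ?(ltW t2b) ?(ltW (lt_trans t12 t2b))//;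
    apply: complex_ext; rewrite ?yt1 ?yt2.
by move=> e'; move: t12; rewrite e' ltxx.
Qed.

Local Notation lam := (abscissa (c t1) (c t2)).
Local Notation strip := (strip (c t1) (c t2) y).

Let lamK (z : R[i]) : Re z = Re (c t1) + lam z * L.
Proof. by rewrite /abscissa divfK// addrC subrK. Qed.

Let lam_chord (s : R) : lam (chord c t1 t2 s) = s.
Proof. by rewrite /abscissa /chord !ReImE mul0r subr0 addrAC subrr add0r mulfK. Qed.

Let Im_chord (s : R) : Im (chord c t1 t2 s) = y.
Proof. by rewrite /chord !ReImE yt1 yt2 subrr mulr0 mul0r !addr0. Qed.

Let eq_chord (z : R[i]) : Im z = y -> z = chord c t1 t2 (lam z).
Proof.
move=> zy; apply: complex_ext; last by rewrite Im_chord.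
by rewrite lamK /chord !ReImE mul0r subr0.
Qed.

(** The rest of the path never touches the closed curve, so the parity of its end can be carried
    back to the points just after [t2]. *)
Let off_arc_end t : t2 < t <= b -> off_curve c t1 t2 (c t).
Proof.
move=> /andP[t2t tb]; have tt : t1 <= t <= b by rewrite tb (ltW (lt_trans t12 t2t)).
split=> [u /andP[u1 u2]|s /andP[s0 s1]]; apply/eqP.
  move=> /c_inj => /(_ _ _) ut.
  have := ut _ tt; rewrite u1 (le_trans u2 (ltW t2b)) => /(_ isT) ut'.
  by move: t2t; rewrite -ut' ltNge u2.
have [->|s00] := eqVneq s 0.
  rewrite chord0 => /c_inj ut; move: t2t; rewrite -ut ?ltNge ?(ltW t12)// lexx.
  exact: ltW (lt_trans t12 t2b).
have [->|s10] := eqVneq s 1.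
  rewrite chord1 => /c_inj ut; move: t2t; rewrite -ut ?ltxx//.
  by rewrite (ltW t12) ltW.
move=> /esym; apply: chord_free => //.
by rewrite !lt_neqAle eq_sym s00 s0 s10 s1.
Qed.

(** [D t] is positive unless [c t] lies on the part of the line between the abscissas [m] and [m'];
    its minimum over the compact interval serves both as height and as sideways margin. *)
Let arc_gap (u v m m' : R) : u <= v ->
  (forall t : R, u <= t <= v -> Im (c t) = y -> m <= lam (c t) <= m' -> False) ->
  exists2 d : R, 0 < d & forall t : R, u <= t <= v ->
    m - d < lam (c t) < m' + d -> d <= `|Im (c t) - y|.
Proof.
move=> uv h.
pose D t := Num.max (`|Im (c t) - y|) (Num.max (m - lam (c t)) (lam (c t) - m')).
have clam : continuous (fun t => lam (c t)).
  by rewrite /abscissa; have [c1 _] := cc; cont.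
have cD : continuous D.
  apply: continuous_maxr; last by apply: continuous_maxr; cont.
  apply: (continuous_comp_real (h := fun x => `|x|)); first exact: norm_continuous.
  by have [_ c2] := cc; cont.
have [t] := EVT_min uv (continuous_subspaceT cD).
rewrite in_itv/= => tuv Dmin.
have Dt : 0 < D t.
  rewrite ltNge; apply/negP; rewrite !ge_max normr_le0 subr_eq0 !subr_le0.
  by move=> /andP[/eqP yt lt]; exact: (h t).
exists (D t) => // w wuv /andP[w1 w2].
have := Dmin w; rewrite in_itv/= => /(_ wuv); rewrite {2}/D !le_max.
case/or3P => //; lra.
Qed.


Let strip_convex m m' d e (z z' : R[i]) : e ^+ 2 = 1 -> strip m m' d e z ->
  strip m m' d e z' ->
  forall s : R, 0 <= s <= 1 -> strip m m' d e (z + (s%:C)%C * (z' - z)).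
Proof.
move=> e1 [/andP[a1 a2] /andP[a3 a4]] [/andP[b1 b2] /andP[b3 b4]] s /andP[s0 s1].
have lamE : lam (z + (s%:C)%C * (z' - z)) = (1 - s) * lam z + s * lam z'.
  by rewrite /abscissa !ReImE; field.
have ImE : e * (Im (z + (s%:C)%C * (z' - z)) - y) =
    (1 - s) * (e * (Im z - y)) + s * (e * (Im z' - y)).
  by rewrite !ReImE; ring.
have cvx (p q r : R) : p < q -> p < r -> p < (1 - s) * q + s * r.
  move=> pq pr; rewrite -subr_gt0 (_ : _ - _ = (1 - s) * (q - p) + s * (r - p));
    last by ring.
  rewrite -(subr_gt0 p) in pq; rewrite -(subr_gt0 p) in pr.
  have [->|s00] := eqVneq s 0; first by rewrite subr0 mul1r mul0r addr0.
  apply: ltr_wpDl; first by rewrite mulr_ge0 ?subr_ge0// -subr_ge0 ltW.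
  by rewrite mulr_gt0// lt_neqAle eq_sym s00.
have cvx' (p q r : R) : q < p -> r < p -> (1 - s) * q + s * r < p.
  move=> pq pr; rewrite -ltrN2 opprD -!mulrN; apply: cvx; by rewrite ltrN2.
by rewrite /strip lamE ImE !cvx// !cvx'.
Qed.

Let strip_path m m' d e (z z' : R[i]) : e ^+ 2 = 1 ->
  (forall w, strip m m' d e w -> off_curve c t1 t2 w) ->
  strip m m' d e z -> strip m m' d e z' ->
  even_point c t1 t2 z -> even_point c t1 t2 z'.
Proof.
move=> e1 off sz sz'; apply: even_point_segment => //; first exact: ltW.
by move=> s s01; apply: off; exact: strip_convex.
Qed.

(** The chord is crossed at an abscissa [m] between [s] and 1. A thin strip above its part from [m]
    to 1 misses the closed curve, since the arc reaches [t2] from below; it contains the path just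
    after [t2], so its points are even. A thin strip below the part from 0 to [m] misses the closed
    curve too, since the arc leaves [t1] upwards. The crossing at [m] then forbids evenness in the
    lower strip, which contains the point below [s]. *)
Lemma below_chord_not_even (s : R) : 0 <= s < 1 -> exists2 d : R, 0 < d & forall e : R,
  0 < e < d ->
  off_curve c t1 t2 (chord c t1 t2 s - (e *i)%C) /\
  ~ even_point c t1 t2 (chord c t1 t2 s - (e *i)%C).
Proof.
move=> /andP[s0 s1].
pose m := (s + 1) / 2.
have sm : s < m by rewrite /m; lra.
have m1 : m < 1 by rewrite /m; lra.
have m0 : 0 < m by rewrite (le_lt_trans s0).
clearbody m.
(* With at most half of [t2 - t1], a time within [eta'] of [t2] is not within [eta'] of [t1], so
   [gap1] or [gap2] applies to every time of the arc. *)
pose eta' := Num.min eta ((t2 - t1) / 2).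
have eta'0 : 0 < eta' by rewrite lt_min eta0 divr_gt0// subr_gt0.
have eta'e : eta' <= eta by rewrite ge_min lexx.
have eta't : eta' <= (t2 - t1) / 2 by rewrite ge_min lexx orbT.
clearbody eta'.
have t1e : t1 + eta' <= t2 by lra.
have t2e : t1 <= t2 - eta' by lra.
have [|d1 d10 gap1] := @arc_gap t1 (t2 - eta') m 1 t2e.
  move=> t /andP[tt1 tt2] yt /andP[l1 l2].
  have t_t2 : t < t2 by rewrite (le_lt_trans tt2)// gtrBl.
  have tb : t1 <= t <= b by rewrite tt1 (ltW (lt_trans t_t2 t2b)).
  have tE := eq_chord yt.
  have [l1E|l1n] := eqVneq (lam (c t)) 1.
    rewrite l1E chord1 in tE.
    by have := c_inj tb _ tE; rewrite (ltW t12) (ltW t2b) => /(_ isT) e; move: t_t2;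
      rewrite e ltxx.
  apply: (@chord_free t (lam (c t)) tb _ tE).
  by rewrite (lt_le_trans m0 l1) lt_neqAle l1n.
have [|d2 d20 gap2] := @arc_gap (t1 + eta') t2 0 m t1e.
  move=> t /andP[tt1 tt2] yt /andP[l1 l2].
  have t1_t : t1 < t by rewrite (lt_le_trans _ tt1)// ltrDl.
  have tb : t1 <= t <= b by rewrite (ltW t1_t) (le_trans tt2 (ltW t2b)).
  have tE := eq_chord yt.
  have [l1E|l1n] := eqVneq (lam (c t)) 0.
    rewrite l1E chord0 in tE.
    by have := c_inj tb _ tE; rewrite lexx ltW ?(lt_trans t12 t2b)// => /(_ isT) e;
      move: t1_t; rewrite e ltxx.
  apply: (@chord_free t (lam (c t)) tb _ tE).
  by rewrite (le_lt_trans l2 m1) lt_neqAle eq_sym l1n l1.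
have off1 w : strip m 1 d1 1 w -> off_curve c t1 t2 w.
  rewrite /strip mul1r => -[w1 /andP[w2 w3]]; split=> [t /andP[tt1 tt2]|u _];
    apply/eqP => e.
    have [tle|tgt] := lerP t (t2 - eta').
      have := gap1 t; rewrite tt1 tle e => /(_ isT w1).
      by rewrite gtr0_norm// leNgt w3.
    have [tE|tn] := eqVneq t t2; first by move: w2; rewrite -e tE yt2 subrr ltxx.
    have : Im (c t) < y by apply: before_t2;
      rewrite (le_lt_trans _ tgt) ?lerB//= lt_neqAle tn.
    by rewrite e; lra.
  by move: w2; rewrite -e Im_chord subrr ltxx.
have off2 w : strip 0 m d2 (-1) w -> off_curve c t1 t2 w.
  rewrite /strip mulN1r opprB => -[w1 /andP[w2 w3]]; split=> [t /andP[tt1 tt2]|u _];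
    apply/eqP => e.
    have [tle|tgt] := lerP (t1 + eta') t.
      have := gap2 t; rewrite tt2 tle e => /(_ isT w1).
      by rewrite distrC gtr0_norm// leNgt w3.
    have [tE|tn] := eqVneq t t1; first by move: w2; rewrite -e tE yt1 subrr ltxx.
    have : y < Im (c t).
      by apply: after_t1; rewrite (lt_le_trans tgt) ?lerD// andbT lt_neqAle eq_sym tn.
    by rewrite e; lra.
  by move: w2; rewrite -e Im_chord subrr ltxx.
have [t [t2t tb stript]] : exists t, [/\ t2 < t, t <= b & strip m 1 d1 1 (c t)].
  have clam : continuous (fun t => lam (c t)).
    by rewrite /abscissa; have [c1 _] := cc; cont.
  have cIm : continuous (fun t => Im (c t)) by case: cc.
  have l2 : lam (c t2) = 1 by rewrite /abscissa divff.
  have near1 : \forall t \near t2, m - d1 < lam (c t).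
    by apply: (cvgr_gt (lam (c t2)) (clam t2)); rewrite l2; lra.
  have near2 : \forall t \near t2, lam (c t) < 1 + d1.
    by apply: (cvgr_lt (lam (c t2)) (clam t2)); rewrite l2; lra.
  have near3 : \forall t \near t2, Im (c t) < y + d1.
    by apply: (cvgr_lt (Im (c t2)) (cIm t2)); rewrite yt2; lra.
  have [t /andP[ta tb]] : exists2 t, t2 < t < Num.min b (t2 + eta) &
      [/\ m - d1 < lam (c t), lam (c t) < 1 + d1 & Im (c t) < y + d1].
    near t2^'+ => t; exists t.
      apply/andP; split=> //; near: t; apply: nbhs_right_lt.
      by rewrite lt_min t2b ltrDl.
    by split; near: t; [exact: cvg_within near1 | exact: cvg_within near2 |
      exact: cvg_within near3].
  move=> [h1 h2 h3]; move: tb; rewrite lt_min => /andP[tb te].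
  exists t; split => //; first exact: ltW.
  split; first by rewrite h1 h2.
  have : y < Im (c t) by apply: after_t2; rewrite ta te.
  by rewrite mul1r; lra.
have even_t : even_point c t1 t2 (c t).
  (* The end of the path is run backwards, from [b] to [t]. *)
  have cp : ccontinuous (fun u => c (t + b - u)).
    by apply: (ccontinuous_comp (h := fun u => t + b - u)) => //; cont.
  have offp u : t <= u <= b -> off_curve c t1 t2 (c (t + b - u)).
    by move=> /andP[u1 u2]; apply: off_arc_end; apply/andP; split; lra.
  have := even_point_path cc (ltW t12) tb cp offp.
  by rewrite addrAC subrr add0r addrK; apply.
exists d2 => // e /andP[e0 ed2].
have strip_s : strip 0 m d2 (-1) (chord c t1 t2 s - (e *i)%C).
  rewrite /strip; have -> : lam (chord c t1 t2 s - (e *i)%C) = s.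
    by rewrite -[RHS]lam_chord /abscissa cReD cReN /= oppr0 addr0.
  rewrite cImD cImN Im_chord /=; split; apply/andP; split; lra.
split; first exact: off2.
pose x := Re (chord c t1 t2 m).
(* Low enough for the upper strip, of height [d1], and at most [e], hence within the lower one. *)
pose e' := Num.min e (d1 / 2).
have e'0 : 0 < e' by rewrite lt_min e0 divr_gt0.
have e'e : e' <= e by rewrite ge_min lexx.
have e'd1 : e' < d1.
  by apply: (@le_lt_trans _ _ (d1 / 2)); [rewrite ge_min lexx orbT | lra].
have lamx (v : R) : lam (x +i* v)%C = m by rewrite -[RHS]lam_chord.
have up : even_point c t1 t2 (x +i* (y + e'))%C.
  apply: strip_path stript _ even_t => //; first by rewrite expr1n.
  by rewrite /strip lamx /=; split; apply/andP; split; lra.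
move=> even_s.
have down : even_point c t1 t2 (x +i* (y - e'))%C.
  apply: strip_path strip_s _ even_s => //; first by rewrite sqrrN expr1n.
  by rewrite /strip lamx /=; split; apply/andP; split; lra.
apply: (not_even_across_chord cc (ltW t12) yt1 yt2 _ e'0 _ up down).
  rewrite /x lamK lam_chord [in X in _ * X](lamK (c t2)).
  have -> : lam (c t2) = 1 by rewrite /abscissa divff.
  rewrite (_ : _ * _ = m * (1 - m) * L ^+ 2); last by ring.
  by apply: mulr_gt0; [rewrite mulr_gt0 ?subr_gt0 | rewrite exprn_even_gt0].
move=> u /andP[u1 u2] ux.
have lu : lam (c u) = m by rewrite -(lamx 0) /abscissa /= ux.
have e'u : e' < `|Im (c u) - y|.
  have [ule|ugt] := lerP u (t2 - eta').
    apply: (lt_le_trans e'd1); apply: gap1; rewrite ?u1 ?ule// lu.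
    by apply/andP; split; lra.
  apply: (le_lt_trans e'e); apply: (lt_le_trans ed2); apply: gap2.
    by rewrite u2 andbT; lra.
  by rewrite lu; apply/andP; split; lra.
by rewrite -[X in _ < X]real_normK ?num_real// ltr_pXn2r ?nnegrE// ltW.
Unshelve. all: by end_near. Qed.

End BelowChord.

(** * Maxima on compact subsets of the plane *)

Section PlaneMaximum.
Variable R : realType.

Lemma continuous_exp (T : topologicalType) (f : T -> R) (n : nat) :
  continuous f -> continuous (fun x => f x ^+ n).
Proof.
move=> cf; elim: n => [|n IH]; first by move=> x; exact: cvg_cst.
by apply: (continuous_ext (fun x => esym (exprS (f x) n))); cont.
Qed.

Lemma ccontinuous_pair : ccontinuous (fun p : R * R => (p.1 +i* p.2)%C).
Proof. by split=> p; [exact: cvg_fst | exact: cvg_snd]. Qed.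

Lemma plane_maximum (K : set R[i]) (g : R[i] -> R) (B : R) :
  K !=set0 -> (forall z, K z -> normsq z <= B ^+ 2) ->
  (forall z, ~ K z -> exists2 d : R, 0 < d & forall z', normsq (z' - z) < d -> ~ K z') ->
  continuous (fun p : R * R => g (p.1 +i* p.2)%C) ->
  exists2 z0, K z0 & forall z, K z -> g z <= g z0.
Proof.
move=> [w Kw] KB Kclosed cg.
pose A : set (R * R) := [set p | K (p.1 +i* p.2)%C].
have A0 : A !=set0 by exists (Re w, Im w); rewrite /A /=; case: (w) Kw.
have cA : compact A.
  apply: (@subclosed_compact _ _ (`[- `|B|, `|B|] `*` `[- `|B|, `|B|])).
  - rewrite closedE => p; apply: contra_notP => /Kclosed[d d0 Kd].
    have cn : continuous (fun q : R * R => normsq ((q.1 +i* q.2)%C - (p.1 +i* p.2)%C)).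
      apply: continuous_normsq;
        apply: (@ccontinuousD _ _ (fun q : R * R => (q.1 +i* q.2)%C)).
        exact: ccontinuous_pair.
      exact: ccontinuous_cst.
    have : \forall q \near p, normsq ((q.1 +i* q.2)%C - (p.1 +i* p.2)%C) < d.
      apply: (cvgr_lt _ (cn p)).
      by rewrite subrr /normsq /= expr0n addr0.
    by apply: filterS => q /Kd.
  - by apply: compact_setX; exact: segment_compact.
  - move=> p /KB; rewrite /normsq /= => pB.
    have sqB : `|B| ^+ 2 = B ^+ 2 by rewrite real_normK ?num_real.
    have bound (x y : R) : x ^+ 2 + y ^+ 2 <= B ^+ 2 -> - `|B| <= x <= `|B|.
      move=> xyB; rewrite -ler_norml -(@ler_pXn2r _ 2) ?nnegrE//.
      by rewrite !real_normK ?num_real// (le_trans _ xyB)// lerDl sqr_ge0.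
    by split; rewrite /= in_itv/=; [apply: (bound _ p.2) | apply: (bound _ p.1);
      rewrite addrC].
have [p pA pmax] := compact_EVT_max A0 cA (continuous_subspaceT cg).
rewrite inE in pA; exists (p.1 +i* p.2)%C => // z Kz.
have := pmax (Re z, Im z); rewrite inE /A /=; case: z Kz => x y Kz; exact.
Qed.

End PlaneMaximum.

(** * Descent curves and the impossibility of an upward free chord *)

Section DescentCurve.
Variables (R : realType) (s : nat) (al : 'I_s -> R[i]) (n : 'I_s -> nat).
Implicit Types (c : R -> R[i]) (z v : R[i]).

Definition modsq z : R := \prod_i normsq (z - al i) ^+ n i.

(* The derivative at [z], in the direction [v], of [log |f|] where
   [|f|^2 = modsq]. *)
Definition log_slope v z : R :=
  \sum_i (n i)%:R * (Re (conjc v * (z - al i)) / normsq (z - al i)).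

(** As [Re (conjc v * w)] is the scalar product of [v] and [w], the last clause says that the
    velocity is a negative multiple of the gradient of [log |f|]. Testing it on every [v] makes it
    stable under rotation and gives heights and half-planes directly. *)
Definition descent_curve c (a b : R) (E : set R) := [/\ ccontinuous c,
  forall t u : R, a <= t -> t < u -> u <= b -> modsq (c u) < modsq (c t),
  finite_set E &
  forall t : R, a < t < b -> ~ E t -> exists2 k : R, 0 < k &
    forall v, is_derive t 1 (fun u => Re (conjc v * c u)) (- k * log_slope v (c t))].

(* Points outside the convex hull of the curve accumulate at its end. *)
Definition exposed_end c (a b : R) := forall d : R, 0 < d ->
  exists z e : R[i], normsq (z - c b) < d /\
    forall t : R, a <= t <= b -> 0 < Re (conjc e * (c t - z)).

Lemma descent_curve_inj c (a b : R) (E : set R) t u : descent_curve c a b E ->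
  a <= t <= b -> a <= u <= b -> c t = c u -> t = u.
Proof.
move=> [_ decr _ _] /andP[at_ tb] /andP[au ub] ctu; apply/eqP; rewrite eq_le !leNgt.
apply/andP; split; apply/negP => tu.
  by have := decr u t au tu tb; rewrite ctu ltxx.
by have := decr t u at_ tu ub; rewrite ctu ltxx.
Qed.

Lemma modsq_ge0 z : 0 <= modsq z.
Proof. by apply: prodr_ge0 => i _; rewrite exprn_ge0 ?normsq_ge0. Qed.

Lemma is_derive_modsq z v : (forall i, z != al i) ->
  is_derive (0 : R) 1 (fun e : R => modsq (z + (e%:C)%C * v)) (2 * modsq z * log_slope v z).
Proof.
move=> zal.
have F0 i : normsq (z + (0%:C)%C * v - al i) != 0.
  by rewrite rmorph0 mul0r addr0 normsq_eq0 subr_eq0 zal.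
have dF i : is_derive (0 : R) 1 (fun e : R => normsq (z + (e%:C)%C * v - al i))
    (2 * Re (conjc v * (z - al i))).
  have -> : (fun e : R => normsq (z + (e%:C)%C * v - al i)) =
      (fun e : R => (normsq v * e + 2 * Re (conjc v * (z - al i))) * e + normsq (z - al i)).
    by apply/funext => e; rewrite /normsq !ReImE; ring.
  have d1 : is_derive (0 : R) 1 (fun e : R =>
    normsq v * e + 2 * Re (conjc v * (z - al i))) (normsq v).
    rewrite -[X in is_derive _ _ _ X]addr0; apply: is_deriveD.
    by rewrite -[X in is_derive _ _ _ X]mulr1; apply: is_derive_cmul; exact: is_derive_id.
  have d2 := is_deriveM d1 (is_derive_id (0 : R) (1 : R)).
  have d3 := is_deriveD d2 (is_derive_cst (normsq (z - al i)) (0 : R) (1 : R)).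
  apply: (is_derive_eq d3).
  by rewrite /GRing.scale/= mulr0 add0r mulr1 mul0r !addr0.
have dP := @is_derive_prod_exp R _ (index_enum 'I_s) n _ _ 0 F0 dF.
apply: (is_derive_eq dP).
rewrite [RHS]mulrAC mulrC; congr (_ * _); last first.
  by apply: eq_bigr => i _; rewrite rmorph0 mul0r addr0.
rewrite /log_slope mulr_sumr; apply: eq_bigr => i _.
by rewrite rmorph0 mul0r addr0; ring.
Qed.

Lemma continuous_modsq : continuous (fun p : R * R => modsq (p.1 +i* p.2)%C).
Proof.
rewrite /modsq; apply: continuous_fprod => i; apply: continuous_exp.
apply: continuous_normsq; apply: (@ccontinuousD _ _ (fun q : R * R => (q.1 +i* q.2)%C)).
  exact: ccontinuous_pair.
exact: ccontinuous_cst.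
Qed.

Hypothesis s_gt0 : (0 < s)%N.
Hypothesis n_gt0 : forall i, (0 < n i)%N.

Lemma exists_larger_modsq z (d : R) : 0 < d ->
  exists2 w, normsq (w - z) < d & modsq z < modsq w.
Proof.
move=> d0; pose f : {poly R[i]} := \prod_i ('X - (al i)%:P) ^+ n i.
have fE w : normsq f.[w] = modsq w.
  rewrite horner_prod /modsq; elim/big_rec2: _ => [|i y x _ <-].
    by rewrite /normsq /= expr1n expr0n addr0.
  rewrite normsqM horner_exp !hornerE; congr (_ * _).
  by elim: (n i) => [|m IH];
    rewrite ?expr0 ?exprS ?normsqM ?IH// /normsq /= expr1n expr0n addr0.
have f0 : f != 0.
  by apply/prodf_neq0 => i _; rewrite expf_neq0// polyXsubC_eq0.
have rf : root f (al (Ordinal s_gt0)).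
  rewrite /root /f horner_prod (bigD1 (Ordinal s_gt0))//= horner_exp !hornerE subrr.
  by rewrite expr0n eqn0Ngt n_gt0 mul0r.
have [w w1 w2] := exists_larger_normsq z (root_size_gt1 f0 rf) d0.
by exists w => //; rewrite -!fE.
Qed.

(* Below the chord the winding number is odd, so the set [K] of the points on
   the closed curve or with odd winding number is entered by [|f|] increasing
   through the chord; hence [|f|] has no maximum on [K]. *)
Lemma no_upward_chord c (a b t1 t2 y : R) (E : set R) :
  descent_curve c a b E -> exposed_end c a b ->
  a < t1 -> t1 < t2 -> t2 < b -> ~ E t1 -> ~ E t2 ->
  Im (c t1) = y -> Im (c t2) = y ->
  (forall t u : R, a <= t <= b -> 0 < u < 1 -> c t <> chord c t1 t2 u) ->
  (forall u : R, 0 <= u <= 1 -> (forall i, chord c t1 t2 u != al i) /\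
     log_slope 'i%C (chord c t1 t2 u) < 0) -> False.
Proof.
move=> dc exposed at1 t12 t2b nE1 nE2 yt1 yt2 chord_free slope.
have ab : a <= b by rewrite ltW// (lt_trans at1)// (lt_trans t12).
have t1b : t1 < b := lt_trans t12 t2b.
have at2 : a < t2 := lt_trans at1 t12.
have [cc decr _ der] := dc.
have c_inj t u := descent_curve_inj (t := t) (u := u) dc.
have up t : a < t < b -> ~ E t -> log_slope 'i%C (c t) < 0 ->
    exists2 e, 0 < e & forall u, (t < u < t + e -> Im (c t) < Im (c u)) /\
    (t - e < u < t -> Im (c u) < Im (c t)).
  move=> tab nEt st; have [k k0 /(_ 'i%C) dk] := der t tab nEt.
  apply: (@is_derive_gt0_local R (fun u => Im (c u)) _ (- k * log_slope 'i%C (c t))).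
    have -> : (fun u => Im (c u)) = (fun u => Re (conjc 'i%C * c u)) => //.
    by apply/funext => u; rewrite !ReImE; ring.
  by rewrite mulNr -mulrN mulr_gt0// oppr_gt0.
have [e1 e10 up1] : exists2 e, 0 < e & forall u, (t1 < u < t1 + e ->
  Im (c t1) < Im (c u)) /\
    (t1 - e < u < t1 -> Im (c u) < Im (c t1)).
  apply: up => //; first by rewrite at1.
  by rewrite -(chord0 c t1 t2); apply: (slope 0 _).2; rewrite lexx ler01.
have [e2 e20 up2] : exists2 e, 0 < e & forall u, (t2 < u < t2 + e ->
  Im (c t2) < Im (c u)) /\
    (t2 - e < u < t2 -> Im (c u) < Im (c t2)).
  apply: up => //; first by rewrite at2.
  by rewrite -(chord1 c t1 t2); apply: (slope 1 _).2; rewrite lexx ler01.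
have sub_ab t : t1 <= t <= b -> a <= t <= b.
  by move=> /andP[t1t ->]; rewrite (le_trans (ltW at1) t1t).
have inj' t u : t1 <= t <= b -> t1 <= u <= b -> c t = c u -> t = u.
  by move=> /sub_ab + /sub_ab; exact: c_inj.
have free' t u : t1 <= t <= b -> 0 < u < 1 -> c t <> chord c t1 t2 u.
  by move=> /sub_ab; exact: chord_free.
have e0 : 0 < Num.min e1 e2 by rewrite lt_min e10.
have ee1 : Num.min e1 e2 <= e1 by rewrite ge_min lexx.
have ee2 : Num.min e1 e2 <= e2 by rewrite ge_min lexx orbT.
have after1 t : t1 < t < t1 + Num.min e1 e2 -> y < Im (c t).
  by move=> /andP[ta tb]; rewrite -yt1; apply: (up1 t).1;
    rewrite ta (lt_le_trans tb)// lerD.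
have before2 t : t2 - Num.min e1 e2 < t < t2 -> Im (c t) < y.
  by move=> /andP[ta tb]; rewrite -yt2; apply: (up2 t).2;
    rewrite tb (le_lt_trans _ ta)// lerB.
have after2 t : t2 < t < t2 + Num.min e1 e2 -> y < Im (c t).
  by move=> /andP[ta tb]; rewrite -yt2; apply: (up2 t).1;
    rewrite ta (lt_le_trans tb)// lerD.
have off_b : off_curve c t1 t2 (c b).
  split=> [t /andP[ta tb]|u /andP[u0 u1]]; apply/eqP => e.
    have tE : t = b by apply: c_inj => //;
      rewrite ?ab ?lexx// (le_trans (ltW at1) ta) ltW ?(le_lt_trans tb).
    by move: tb; rewrite tE leNgt t2b.
  have [u0E|u0n] := eqVneq u 0.
    move: e; rewrite u0E chord0 => e; have t1E : t1 = b by apply: c_inj;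
      rewrite ?ab ?lexx ?(ltW at1) ?ltW.
    by move: t1b; rewrite t1E ltxx.
  have [u1E|u1n] := eqVneq u 1.
    move: e; rewrite u1E chord1 => e; have t2E : t2 = b by apply: c_inj;
      rewrite ?ab ?lexx ?(ltW at2) ?ltW.
    by move: t2b; rewrite t2E ltxx.
  apply: (chord_free b u _ _ (esym e)); first by rewrite ab lexx.
  by rewrite !lt_neqAle eq_sym u0n u0 u1n u1.
(* Near [c b] there is a point that sees the whole curve in a half-plane, hence is even; [c b] is
   off the closed curve and shares its parity. *)
have even_b : even_point c t1 t2 (c b).
  have [d d0 ball] := off_curve_ball cc (ltW t12) off_b.
  have [z [e [zd ez]]] := exposed d d0.
  apply/(ball z zd).2;
    apply: (even_point_halfplane cc (ltW t12) (e := e)) => t /andP[ta tb].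
  by apply: ez; rewrite (le_trans (ltW at1) ta) (le_trans tb (ltW t2b)).
have below := below_chord_not_even cc t12 t2b inj' free' yt1 yt2 e0 after1 before2 after2
  even_b.
pose K : set R[i] := [set z | ~ (off_curve c t1 t2 z /\ even_point c t1 t2 z)].
have K0 : K (c t1).
  by move=> [[/(_ t1)]]; rewrite lexx (ltW t12) eqxx => /(_ isT).
have cnorm : continuous (fun t => normsq (c t)) by exact: continuous_normsq.
have [tm _ tmax] := EVT_max ab (continuous_subspaceT cnorm).
(* A point far from the origin sees the closed curve in a half-plane facing the origin. The bound is
   a square to fit [plane_maximum], and [(M + 1) ^ 2] exceeds [M] for [M >= 0]. *)
have KB z : K z -> normsq z <= (normsq (c tm) + 1) ^+ 2.
  move=> Kz; rewrite leNgt; apply/negP => zB; apply: Kz.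
  have nz : forall t, t1 <= t <= t2 -> 0 < Re (conjc (- z) * (c t - z)).
    move=> t /andP[ta tb]; have := tmax t;
      rewrite in_itv/= (le_trans (ltW at1) ta) (le_trans tb (ltW t2b)).
    move=> /(_ isT) ct.
    have -> : Re (conjc (- z) * (c t - z)) =
       (normsq z - normsq (c t) + normsq (c t - z)) / 2 by rewrite /normsq !ReImE; field.
    rewrite divr_gt0// ltr_wpDr ?normsq_ge0// subr_gt0 (le_lt_trans ct)//.
    apply: le_lt_trans zB; have := normsq_ge0 (c tm); set q := normsq _ => q0.
    by rewrite expr2; nra.
  split; first exact: (off_curve_halfplane (ltW t12) (e := - z) nz).
  exact: (even_point_halfplane cc (ltW t12) (e := - z) nz).
have Kclosed z : ~ K z -> exists2 d : R, 0 < d & forall z', normsq (z' - z) < d -> ~ K z'.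
  move=> /contrapT[offz evz]; have [d d0 ball] := off_curve_ball cc (ltW t12) offz.
  by exists d => // z' /ball[oz' [ez _]]; apply; split=> //; exact: ez.
have [z0 Kz0 zmax] := plane_maximum (ex_intro _ _ K0) KB Kclosed continuous_modsq.
have Ksub z : K z -> modsq z <= modsq z0 by exact: zmax.
have arc_no t : t1 < t <= t2 -> c t <> z0.
  move=> /andP[ta tb] e; have := Ksub _ K0; rewrite -e leNgt => /negP; apply.
  by apply: decr => //; [exact: ltW | exact: le_trans tb (ltW t2b)].
(* The end [u = 1] is [c t2], already treated as a point of the arc. From the others, moving in the
   direction [- 'i] enters [K] and increases the modulus. *)
have chord_no u : 0 <= u < 1 -> chord c t1 t2 u <> z0.
  move=> u01 e; have [d d0 bd] := below u u01.
  have [al0 sl] : (forall i,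
    chord c t1 t2 u != al i) /\ log_slope 'i%C (chord c t1 t2 u) < 0.
    by apply: slope; move: u01 => /andP[-> /ltW].
  have dm := is_derive_modsq (- 'i%C) al0.
  have slN : log_slope (- 'i%C) (chord c t1 t2 u) = - log_slope 'i%C (chord c t1 t2 u).
    rewrite /log_slope -sumrN; apply: eq_bigr => i _.
    by rewrite -mulrN -mulNr; congr (_ * (_ / _)); rewrite rmorphN mulNr cReN.
  have m0 : 0 < modsq (chord c t1 t2 u).
    by apply: prodr_gt0 => i _; rewrite exprn_gt0// normsq_gt0 subr_eq0.
  have dpos : 0 < 2 * modsq (chord c t1 t2 u) * log_slope (- 'i%C) (chord c t1 t2 u).
    by rewrite slN !mulr_gt0 ?oppr_gt0.
  have [e' e'0 loc] := is_derive_gt0_local dm dpos.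
  pose x := Num.min (d / 2) (e' / 2).
  have x0 : 0 < x by rewrite lt_min !divr_gt0.
  have xd : x < d by apply: (@le_lt_trans _ _ (d / 2));
    [rewrite ge_min lexx | rewrite gtr_pMr// invf_lt1 ?ltr1n].
  have xe : x < e' by apply: (@le_lt_trans _ _ (e' / 2));
    [rewrite ge_min lexx orbT | rewrite gtr_pMr// invf_lt1 ?ltr1n].
  have := (loc x).1; rewrite x0 add0r xe => /(_ isT).
  rewrite rmorph0 mul0r addr0 e ltNge => /negP; apply; apply: Ksub.
  have -> : z0 + (x%:C)%C * - 'i%C = chord c t1 t2 u - (x *i)%C.
    by rewrite e; congr (_ + _); apply: complex_ext; rewrite !ReImE /=; ring.
  by move=> [_]; have [|_] := bd x; rewrite ?x0.
have off0 : off_curve c t1 t2 z0.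
  split=> [t /andP[ta tb]|u /andP[u0 u1]]; apply/eqP => e.
    have [tE|tn] := eqVneq t t1.
      by apply: (chord_no 0); rewrite ?lexx ?ltr01// chord0 -tE.
    by apply: (arc_no t) => //; rewrite tb lt_neqAle eq_sym tn ta.
  have [uE|un] := eqVneq u 1.
    by apply: (arc_no t2); rewrite ?t12 ?lexx// -(chord1 c t1 t2) -uE.
  by apply: (chord_no u) => //; rewrite u0 lt_neqAle un u1.
have [d d0 ball] := off_curve_ball cc (ltW t12) off0.
have [w wd] := exists_larger_modsq z0 d0.
rewrite ltNge => /negP; apply; apply: Ksub => -[_ ew].
by apply: Kz0; split=> //; apply/(ball w wd).2.
Qed.

End DescentCurve.

(** * Rotation of the roots and the curve *)

Section Rotation.
Variables (R : realType) (s : nat) (al : 'I_s -> R[i]) (n : 'I_s -> nat).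
Implicit Types (c : R -> R[i]) (u v z : R[i]).

Lemma modsq_rotate u z : normsq u = 1 ->
  modsq (fun i => u * al i) n (u * z) = modsq al n z.
Proof.
by move=> u1; apply: eq_bigr => i _; rewrite -mulrBr normsqM u1 mul1r.
Qed.

Lemma log_slope_rotate u v z : normsq u = 1 ->
  log_slope (fun i => u * al i) n v (u * z) = log_slope al n (conjc u * v) z.
Proof.
move=> u1; apply: eq_bigr => i _; rewrite -mulrBr normsqM u1 mul1r.
by congr (_ * (Re _ / _)); rewrite rmorphM/= conjcK; ring.
Qed.

Lemma descent_curve_rotate u c a b E : normsq u = 1 ->
  descent_curve al n c a b E ->
  descent_curve (fun i => u * al i) n (fun t => u * c t) a b E.
Proof.
move=> u1 [cc decr fE der]; split=> //.
- by apply: ccontinuousM; [exact: ccontinuous_cst | exact: cc].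
- by move=> t t' at_ tt' tb; rewrite !modsq_rotate//; exact: decr.
- move=> t tab nE; have [k k0 dk] := der t tab nE; exists k => // v.
  rewrite log_slope_rotate//; have := dk (conjc u * v).
  have -> // : (fun w => Re (conjc (conjc u * v) * c w)) = (fun w =>
    Re (conjc v * (u * c w))).
  by apply/funext => w; rewrite rmorphM/= conjcK; congr Re; ring.
Qed.

Lemma exposed_end_rotate u c a b : normsq u = 1 ->
  exposed_end c a b -> exposed_end (fun t => u * c t) a b.
Proof.
move=> u1 ex d /ex[z [e [zd ze]]]; exists (u * z), (u * e); split.
  by rewrite -mulrBr normsqM u1 mul1r.
move=> t /ze; rewrite -mulrBr rmorphM/= mulrACA [conjc u * u]mulrC mulc_conj u1.
by rewrite rmorph1 mul1r.
Qed.

End Rotation.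

(** * Neighbouring crossings of a horizontal line *)

Section LineCrossings.
Variables (R : realType) (s : nat) (al : 'I_s -> R[i]) (n : 'I_s -> nat).
Variables (c : R -> R[i]) (a b : R) (E : set R).
Hypothesis s_gt0 : (0 < s)%N.
Hypothesis n_gt0 : forall i, (0 < n i)%N.
Hypothesis dc : descent_curve al n c a b E.
Hypothesis ex : exposed_end c a b.

Let chord_between t1 t2 y (u : R) : Im (c t1) = y -> Im (c t2) = y ->
  [/\ Im (chord c t1 t2 u) = y & (Re (chord c t1 t2 u) - Re (c t1)) *
    (Re (c t2) - Re (chord c t1 t2 u)) = u * (1 - u) * (Re (c t2) - Re (c t1)) ^+ 2].
Proof. by move=> y1 y2; rewrite /chord !ReImE y1 y2; split; ring. Qed.

(** Betweenness on the line is written as the sign of a product, which does not depend on which end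
    is on the left; hence the ends may be exchanged to get [t1 < t2]. *)
Lemma no_free_chord_upward t1 t2 y : a < t1 < b -> a < t2 < b -> t1 != t2 ->
  ~ E t1 -> ~ E t2 -> Im (c t1) = y -> Im (c t2) = y ->
  (forall i, Im (al i) != y) ->
  (forall t, a <= t <= b -> Im (c t) = y ->
    (Re (c t) - Re (c t1)) * (Re (c t2) - Re (c t)) <= 0) ->
  (forall x : R, 0 <= (x - Re (c t1)) * (Re (c t2) - x) ->
    log_slope al n 'i%C (x +i* y)%C < 0) -> False.
Proof.
wlog t12 : t1 t2 / t1 < t2.
  move=> wl t1ab t2ab t1t2; have [/wl H|t2t1 nE1 nE2 y1 y2 aly free slope] := ltP t1 t2;
    first exact: H.
  apply: (wl t2 t1) => //; rewrite ?(eq_sym t2)//.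
  - by rewrite lt_neqAle eq_sym t1t2.
  - by move=> t tab ty; rewrite mulrC -mulrNN !opprB; exact: free.
  - by move=> x x0; apply: slope; rewrite mulrC -mulrNN !opprB.
move=> /andP[at1 t1b] /andP[at2 t2b] _ nE1 nE2 y1 y2 aly free slope.
have L0 : Re (c t2) - Re (c t1) != 0.
  rewrite subr_eq0; apply/eqP => e; have t21 : t2 = t1.
    apply: (descent_curve_inj dc); rewrite ?(ltW at1) ?(ltW at2) ?(ltW t1b) ?(ltW t2b)//.
    by apply: complex_ext => //; rewrite y1 y2.
  by move: t12; rewrite t21 ltxx.
apply: (@no_upward_chord R s al n s_gt0 n_gt0 c a b t1 t2 y E) => //.
  move=> t u tab /andP[u0 u1] e; have [yu between] := chord_between u y1 y2.
  have := free t tab; rewrite e yu => /(_ erefl); rewrite between leNgt => /negP; apply.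
  apply: mulr_gt0; first by rewrite mulr_gt0// subr_gt0.
  by rewrite exprn_even_gt0.
move=> u /andP[u0 u1]; have [yu between] := chord_between u y1 y2; split.
  by move=> i; apply: contra_eq_neq yu => ->; exact: aly.
have := slope (Re (chord c t1 t2 u)); rewrite between => sl.
have -> : chord c t1 t2 u = (Re (chord c t1 t2 u) +i* y)%C.
  by apply: complex_ext => //=.
by apply: sl; apply: mulr_ge0; rewrite ?sqr_ge0// mulr_ge0 ?subr_ge0.
Qed.

End LineCrossings.

Section Crossings.
Variables (R : realType) (s : nat) (al : 'I_s -> R[i]) (n : 'I_s -> nat).
Variables (c : R -> R[i]) (a b : R) (E : set R).
Hypothesis s_gt0 : (0 < s)%N.
Hypothesis n_gt0 : forall i, (0 < n i)%N.
Hypothesis dc : descent_curve al n c a b E.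
Hypothesis ex : exposed_end c a b.

(** The slope has a constant sign on the segment; if it is positive, the half turn [-1] reverses
    it. *)
Lemma no_free_chord t1 t2 y : a < t1 < b -> a < t2 < b -> t1 != t2 ->
  ~ E t1 -> ~ E t2 -> Im (c t1) = y -> Im (c t2) = y ->
  (forall i, Im (al i) != y) ->
  (forall t, a <= t <= b -> Im (c t) = y ->
    (Re (c t) - Re (c t1)) * (Re (c t2) - Re (c t)) <= 0) ->
  (forall x x' : R, 0 <= (x - Re (c t1)) * (Re (c t2) - x) ->
    0 <= (x' - Re (c t1)) * (Re (c t2) - x') ->
    0 < log_slope al n 'i%C (x +i* y)%C * log_slope al n 'i%C (x' +i* y)%C) -> False.
Proof.
move=> t1ab t2ab t12 nE1 nE2 y1 y2 aly free slope.
set x1 := Re (c t1) in slope free *.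
have x1in : 0 <= (x1 - x1) * (Re (c t2) - x1) by rewrite subrr mul0r.
have [lt0|ge0] := ltP (log_slope al n 'i%C (x1 +i* y)%C) 0.
  apply: (no_free_chord_upward s_gt0 n_gt0 dc ex t1ab t2ab t12 nE1 nE2 y1 y2 aly free).
  by move=> x xin; rewrite -(nmulr_rgt0 _ lt0); exact: slope.
have gt0 : 0 < log_slope al n 'i%C (x1 +i* y)%C.
  rewrite lt_neqAle ge0 andbT; apply/eqP => e.
  by have := slope x1 x1 x1in x1in; rewrite -e mul0r ltxx.
have uN : normsq (-1 : R[i]) = 1 by rewrite normsqN /normsq /= expr1n expr0n addr0.
have dcN := descent_curve_rotate uN dc; have exN := exposed_end_rotate uN ex.
apply: (no_free_chord_upward (y := - y) s_gt0 n_gt0 dcN exN t1ab t2ab t12 nE1 nE2).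
- by rewrite mulN1r cImN y1.
- by rewrite mulN1r cImN y2.
- by move=> i; rewrite mulN1r cImN eqr_opp.
- move=> t tab; rewrite !mulN1r cImN !cReN => /oppr_inj ty.
  rewrite (_ : _ * _ = (Re (c t) - x1) * (Re (c t2) - Re (c t))); last by rewrite /x1; ring.
  exact: free.
move=> x; rewrite !mulN1r !cReN => xin.
have -> : (x +i* - y)%C = -1 * ((- x) +i* y)%C.
  by rewrite mulN1r; apply: complex_ext; rewrite !ReImE /= ?opprK.
rewrite log_slope_rotate// -oppr_gt0.
have -> : - log_slope al n (conjc (-1) * 'i%C) (- x +i* y)%C = log_slope al n 'i%C (- x
  +i* y)%C.
  rewrite /log_slope -sumrN; apply: eq_bigr => i _.
  rewrite -mulrN -mulNr -cReN; congr (_ * (Re _ / _)).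
  have -> : conjc (-1) = -1 :> R[i] by rewrite rmorphN rmorph1.
  by rewrite mulN1r rmorphN mulNr opprK.
rewrite -(pmulr_rgt0 _ gt0); apply: slope => //.
by rewrite (_ : _ * _ = (x - - x1) * (- Re (c t2) - x)) //; ring.
Qed.

End Crossings.

(** * The slope along a line and its polynomial *)

Section LocalBehaviour.
Variable R : realType.

Lemma is_derive_neq0_local (h : R -> R) (t d : R) : is_derive t 1 h d -> d != 0 ->
  exists2 e : R, 0 < e & forall u : R, u != t -> `|u - t| < e -> h u != h t.
Proof.
move=> dh d0.
have side (g : R -> R) (d' : R) : is_derive t 1 g d' -> 0 < d' ->
    exists2 e : R, 0 < e & forall u : R, u != t -> `|u - t| < e -> g u != g t.
  move=> dg d'0; have [e e0 loc] := is_derive_gt0_local dg d'0.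
  exists e => // u; rewrite neq_lt ltr_distl => /orP[ut|tu] /andP[l r].
    by rewrite lt_eqF// (loc u).2// l ut.
  by rewrite gt_eqF// (loc u).1// tu r.
move: d0; rewrite neq_lt => /orP[dneg|dpos]; last exact: side dh dpos.
have dN : is_derive t 1 (fun u => - h u) (- d) by exact: is_deriveN.
have dN0 : 0 < - d by rewrite oppr_gt0.
have [e e0 loc] := side _ _ dN dN0.
by exists e => // u ut ue; have := loc u ut ue; rewrite eqr_opp.
Qed.

Lemma continuous_at_fsum (T : topologicalType) (I : Type) (r : seq I)
    (F : I -> T -> R) (x : T) :
  (forall i, {for x, continuous (F i)}) ->
  {for x, continuous (fun y => \sum_(i <- r) F i y)}.
Proof.
move=> cF; elim: r => [|i r IH]; rewrite /prop_for /continuous_at.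
  by rewrite big_nil; under eq_fun do rewrite big_nil; exact: cvg_cst.
rewrite big_cons; under eq_fun do rewrite big_cons.
exact: (cvgD (cF i) IH).
Qed.

End LocalBehaviour.

Section Levels.
Variables (R : realType) (s : nat) (al : 'I_s -> R[i]) (n : 'I_s -> nat).

Lemma log_slope_continuous (T : topologicalType) (z : T -> R[i]) v (x : T) :
  ccontinuous z -> (forall i, z x != al i) ->
  {for x, continuous (fun t => log_slope al n v (z t))}.
Proof.
move=> cz zal; apply: continuous_at_fsum => i.
have cw : ccontinuous (fun t => z t - al i) by ccont.
have cv : ccontinuous (fun t => conjc v * (z t - al i)) by ccont.
apply: cvgM; first exact: cvg_cst.
apply: cvgM; first exact: (cv.1 x).
have cn := @continuous_normsq R T _ cw x; apply: cvgV; last exact: cn.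
by rewrite normsq_eq0 subr_eq0.
Qed.

(* [log_slope 'i] at [x + i y], multiplied by all the [|x + i y - al j|^2]. *)
Definition line_poly (y : R) : {poly R} :=
  \sum_i ((n i)%:R * (y - Im (al i))) *:
    \prod_(j | j != i) (('X - (Re (al j))%:P) ^+ 2 + ((y - Im (al j)) ^+ 2)%:P).

(** Each summand is a multiple of a product of [s - 1] quadratic polynomials: degree at most
    [2 s - 2], so size at most [2 s - 1]. *)
Lemma size_line_poly y : (size (line_poly y) <= (2 * s).-1)%N.
Proof.
have sq2 (i : 'I_s) : size (('X - (Re (al i))%:P) ^+ 2 + ((y - Im (al i)) ^+ 2)%:P) = 3%N.
  rewrite size_polyDl ?size_exp_XsubC//.
  by rewrite (leq_ltn_trans (size_polyC_leq1 _)).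
apply: leq_trans (size_sum _ _ _) _; apply/bigmax_leqP => i _.
apply: leq_trans (size_scale_leq _ _) _.
apply: leq_trans (size_prod_leq _ _) _.
under eq_bigr do rewrite sq2.
rewrite sum_nat_const (cardC1 i) card_ord.
by move: (leq_ltn_trans (leq0n i) (ltn_ord i)); clear; case: (s) => // m _;
  rewrite [m.+1.-1]/= mulnSr -addSn addnK mulnC mulnS.
Qed.

Lemma line_polyE (x y : R) : (forall i, Im (al i) != y) ->
  (line_poly y).[x] =
    log_slope al n 'i%C (x +i* y)%C * \prod_j normsq ((x +i* y)%C - al j).
Proof.
move=> aly; rewrite /line_poly horner_sum /log_slope mulr_suml; apply: eq_bigr => i _.
have n0 : normsq ((x +i* y)%C - al i) != 0.
  rewrite normsq_eq0 subr_eq0; apply/eqP => /(congr1 (@complex.Im R))/= e.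
  by have := aly i; rewrite -e eqxx.
rewrite hornerZ horner_prod [in RHS](bigD1 i)//= -!mulrA mulKf//; congr (_ * _).
have -> : Re (conjc 'i%C * ((x +i* y)%C - al i)) = y - Im (al i) by rewrite !ReImE /=; ring.
congr (_ * _); apply: eq_bigr => j _.
rewrite hornerD horner_exp hornerXsubC hornerC /normsq !ReImE //.
Qed.

End Levels.

(** * Counting the crossings of a line *)

Section PolyRoots.
Variable R : realType.

Lemma size_le_of_separating_roots (q : {poly R}) (x0 : R) (xs : seq R) :
  q != 0 -> path <%R x0 xs ->
  (forall x x' : R, x \in x0 :: xs -> x' \in x0 :: xs -> x < x' ->
     exists2 z, x < z < x' & root q z) ->
  (size xs < size q)%N.
Proof.
move=> q0 px sep.
suff [rs [rs1 rs2 <- _]] : exists rs : seq R,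
    [/\ uniq rs, all (root q) rs, size rs = size xs & forall r, r \in rs -> x0 < r].
  exact: max_poly_roots.
elim: xs x0 px sep => [|x1 xs IH] x0 px sep; first by exists [::].
have /andP[x01 px1] : (x0 < x1) && path <%R x1 xs by exact: px.
have sep1 x x' : x \in x1 :: xs -> x' \in x1 :: xs -> x < x' -> exists2 z,
  x < z < x' & root q z.
  by move=> xin x'in; apply: sep; rewrite inE ?xin ?x'in orbT.
have [rs [u1 a1 s1 g1]] := IH x1 px1 sep1.
have [z /andP[z0 z1] rz] : exists2 z, x0 < z < x1 & root q z.
  by apply: sep => //; rewrite !inE eqxx ?orbT.
exists (z :: rs); split=> //=.
- rewrite u1 andbT; apply/negP => /g1; rewrite ltNge => /negP; apply; exact: ltW.
- by rewrite rz a1.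
- by rewrite s1.
- by move=> r; rewrite inE => /predU1P[->//|/g1]; exact: lt_trans.
Qed.

End PolyRoots.

Section CrossingCount.
Variables (R : realType) (s : nat) (al : 'I_s -> R[i]) (n : 'I_s -> nat).
Variables (c : R -> R[i]) (a b : R) (E : set R).
Hypothesis s_gt0 : (0 < s)%N.
Hypothesis n_gt0 : forall i, (0 < n i)%N.
Hypothesis dc : descent_curve al n c a b E.
Hypothesis ex : exposed_end c a b.

(** If the slope had no zero between, it would be nonzero on the whole segment and [t1] would be
    isolated among the times on the line. So [c t1] would have a nearest neighbour [c t3] towards
    [c t2], with nothing of the path in between and a slope of constant sign, against
    [no_free_chord]. *)
Lemma critical_between t1 t2 y : a < t1 < b -> a < t2 < b ->
  Im (c t1) = y -> Im (c t2) = y -> Re (c t1) < Re (c t2) ->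
  (forall i, Im (al i) != y) ->
  (forall t, a <= t <= b -> Im (c t) = y -> a < t < b /\ ~ E t) ->
  log_slope al n 'i%C (c t1) != 0 -> log_slope al n 'i%C (c t2) != 0 ->
  exists2 x, Re (c t1) < x < Re (c t2) & log_slope al n 'i%C (x +i* y)%C = 0.
Proof.
move=> t1ab t2ab y1 y2 x12 aly good sl1 sl2; apply: contrapT => noz.
have [cc _ _ der] := dc.
have cIm : continuous (fun t => Im (c t)) := cc.2.
have cRe : continuous (fun t => Re (c t)) := cc.1.
have weak t : a < t < b -> a <= t <= b by move=> /andP[/ltW-> /ltW->].
have nE1 := (good t1 (weak _ t1ab) y1).2.
set x1 := Re (c t1) in x12 noz *; set x2 := Re (c t2) in x12 noz *.
have slope0 x : x1 <= x <= x2 -> log_slope al n 'i%C (x +i* y)%C != 0.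
  move=> /andP[xx1 xx2].
  have [->|xn1] := eqVneq x x1; first by rewrite (_ : (x1 +i* y)%C = c t1)//;
    apply: complex_ext.
  have [->|xn2] := eqVneq x x2; first by rewrite (_ : (x2 +i* y)%C = c t2)//;
    apply: complex_ext.
  apply/eqP => e; apply: noz; exists x => //.
  by rewrite !lt_neqAle xx1 xx2 xn2 eq_sym xn1.
have [k k0 /(_ 'i%C) dk] := der t1 t1ab nE1.
have d0 : - k * log_slope al n 'i%C (c t1) != 0 by rewrite mulf_neq0// oppr_eq0 gt_eqF.
have ImE : (fun u => Re (conjc 'i%C * c u)) = (fun u => Im (c u)).
  by apply/funext => u; rewrite !ReImE; ring.
rewrite ImE in dk; have [e e0 iso] := is_derive_neq0_local dk d0.
(* The condition [e <= |t - t1|] excludes [t1] while keeping the set closed; by [iso] it excludes no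
   other time on the line. *)
pose A : set R := [set t | [/\ a <= t <= b, Im (c t) = y,
  x1 <= Re (c t) <= x2 & e <= `|t - t1|]].
have t12 : t2 != t1 by apply/eqP => e'; move: x12; rewrite /x1 /x2 e' ltxx.
have A0 : A !=set0.
  exists t2; split; [exact: weak | exact: y2 | by rewrite (ltW x12) lexx |].
  rewrite leNgt; apply/negP => /(iso _ t12)/eqP; apply.
  by rewrite y1 y2.
have cA : compact A.
  have -> : A = `[a, b] `&` ((fun t => Im (c t)) @^-1` [set y]) `&`
     (((fun t => Re (c t)) @^-1` [set x | x1 <= x]) `&` ((fun t =>
       Re (c t)) @^-1` [set x | x <= x2])) `&`
     ((fun t => `|t - t1|) @^-1` [set x | e <= x]).
    rewrite eqEsubset; split=> t; rewrite /A /= in_itv/=.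
      by move=> [tab ty /andP[r1 r2] te].
    by move=> [[[tab ty] [r1 r2]] te]; split=> //; rewrite r1 r2.
  apply: compact_closedI.
    apply: compact_closedI.
      apply: compact_closedI; first exact: segment_compact.
      by apply: (@preimage_closed _ _ (fun t => Im (c t))) => //; exact: closed_eq.
    apply: closedI.
      by apply: (@preimage_closed _ _ (fun t => Re (c t))) => //; exact: closed_ge.
    by apply: (@preimage_closed _ _ (fun t => Re (c t))) => //; exact: closed_le.
  have cdist : continuous (fun t : R => `|t - t1|).
    apply: (continuous_comp_real (h := fun x => `|x|)); first exact: norm_continuous.
    by apply: (@continuous_add _ _ (fun t => t)); cont.
  by apply: (@preimage_closed _ _ (fun t : R => `|t - t1|)) => //; exact: closed_ge.
have [t3] := compact_EVT_min A0 cA (continuous_subspaceT cRe).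
rewrite inE => -[t3ab y3 /andP[x31 x32] t3e] tmin.
have [t3ab' nE3] := good t3 t3ab y3.
have t13 : t1 != t3.
  by apply/eqP => e'; move: t3e; rewrite -e' subrr normr0 leNgt e0.
have between x : 0 <= (x - x1) * (Re (c t3) - x) -> x1 <= x <= Re (c t3).
  move=> pos; apply/andP; split; rewrite leNgt; apply/negP => lt; move: pos.
    by rewrite leNgt nmulr_rlt0 ?subr_lt0// subr_gt0 (lt_le_trans lt).
  by rewrite leNgt pmulr_rlt0 ?subr_gt0 ?subr_lt0 ?lt// (le_lt_trans x31).
apply: (no_free_chord s_gt0 n_gt0 dc ex t1ab t3ab' t13 nE1 nE3 y1 y3 aly).
  move=> t tab ty; rewrite leNgt -/x1; apply/negP => pos.
  have /andP[xt1 xt3] := between _ (ltW pos).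
  have tt1 : t != t1.
    by apply: contraTneq pos => ->; rewrite subrr mul0r ltxx.
  have : t \in A.
    rewrite inE; split=> //; first by rewrite xt1 (le_trans xt3).
    by rewrite leNgt; apply/negP => /(iso _ tt1)/eqP; apply; rewrite ty y1.
  move=> /tmin tmin'; have xE : Re (c t) = Re (c t3) by apply/eqP; rewrite eq_le xt3.
  by move: pos; rewrite xE subrr mulr0 ltxx.
pose f x := log_slope al n 'i%C (x +i* y)%C.
have cline : ccontinuous (fun x : R => (x +i* y)%C).
  by split; [move=> x; exact: cvg_id | move=> x; exact: cvg_cst].
have cf : continuous f.
  move=> x; apply: (@log_slope_continuous R s al n _ (fun x : R => (x +i* y)%C)) => // i.
  by apply/eqP => /(congr1 (@complex.Im R))/= e'; have := aly i; rewrite -e' eqxx.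
move=> x x' /between xin /between x'in; rewrite -/(f x) -/(f x').
have range z : x1 <= z <= Re (c t3) -> x1 <= z <= x2.
  by move=> /andP[-> /le_trans->].
have same u v : x1 <= u -> v <= x2 -> u <= v -> 0 < f u * f v.
  move=> u1 v2 uv; apply: continuous_same_sign => // z /andP[uz zv].
  by apply: slope0; rewrite (le_trans u1 uz) (le_trans zv v2).
have /andP[xa xb] := range _ xin; have /andP[xa' xb'] := range _ x'in.
by have [xx'|x'x] := leP x x'; [exact: same | rewrite mulrC; apply: same => //; exact: ltW].
Qed.

Lemma crossings_le (ts : seq R) y : uniq ts ->
  (forall i, Im (al i) != y) ->
  (forall t, a <= t <= b -> Im (c t) = y -> a < t < b /\ ~ E t) ->
  (forall t, t \in ts -> [/\ a <= t <= b, Im (c t) = y & log_slope al n 'i%C (c t) != 0]) ->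
  (size ts <= (2 * s).-1)%N.
Proof.
move=> uts aly good tsP.
pose xs := sort <=%R (map (fun t => Re (c t)) ts).
have sxs : size xs = size ts by rewrite size_sort size_map.
have xsP x : x \in xs -> exists2 t, t \in ts & Re (c t) = x.
  by rewrite mem_sort => /mapP[t tin ->]; exists t.
have uxs : uniq xs.
  rewrite sort_uniq map_inj_in_uniq// => t t' tin t'in ett'.
  have [tab ty _] := tsP t tin; have [t'ab t'y _] := tsP t' t'in.
  by apply: (descent_curve_inj dc) => //; apply: complex_ext => //; rewrite ty.
have sorted_xs : sorted <%R xs by rewrite lt_sorted_uniq_le uxs sort_le_sorted.
have normsq_line x j : normsq ((x +i* y)%C - al j) != 0.
  rewrite normsq_eq0 subr_eq0; apply/eqP => /(congr1 (@complex.Im R))/= e.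
  by have := aly j; rewrite -e eqxx.
rewrite -sxs; case exs : xs => [|x0 xs'] //.
rewrite exs in sorted_xs.
apply: leq_trans (size_line_poly al n y).
apply: (@size_le_of_separating_roots R _ x0 xs') => //.
  (* The polynomial is nonzero because the slope is nonzero at the first crossing. *)
  have x0in : x0 \in xs by rewrite exs inE eqxx.
  have [t tin tx] := xsP x0 x0in.
  have [tab ty sl] := tsP t tin; apply/eqP => q0.
  have := line_polyE n x0 aly; rewrite q0 horner0 => /esym/eqP.
  rewrite mulf_eq0 (_ : (x0 +i* y)%C = c t) ?(negbTE sl)/=; last exact: complex_ext.
  apply/negP/prodf_neq0 => j _; have := normsq_line x0 j.
  by rewrite (_ : (x0 +i* y)%C = c t)//; exact: complex_ext.
move=> x x'; rewrite -exs => /xsP[t tin <-] /xsP[t' t'in <-] lt.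
have [tab ty sl] := tsP t tin; have [t'ab t'y sl'] := tsP t' t'in.
have [z zin z0] := critical_between (good t tab ty).1 (good t' t'ab t'y).1 ty t'y lt aly
  good sl sl'.
by exists z => //; rewrite /root line_polyE// z0 mul0r.
Qed.

End CrossingCount.

(** * Levels crossed with nonzero slope *)

Section RegularLevels.
Variable R : realType.

(** After its last passage at level [p], [h] stays above [p], so it cannot be nonincreasing right
    afterwards: [sg] is positive at some time outside [E], hence around it, and the values taken
    there fill an interval of levels. *)
Lemma regular_levels_up (h sg : R -> R) (u v p q : R) (E : set R) :
  u <= v -> p < q -> continuous h -> finite_set E ->
  (forall t, u < t < v -> {for t, continuous sg}) ->
  (forall t, u < t < v -> ~ E t -> exists2 k : R, 0 < k & is_derive t 1 h (k * sg t)) ->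
  h u <= p -> q <= h v ->
  exists p' q', [/\ p <= p', p' < q', q' <= q &
    forall y, p' < y < q' -> exists2 t, u < t < v & h t = y /\ sg t != 0].
Proof.
move=> uv pq ch fE csg dh hup hqv.
have [s0 [/andP[us0 s0v] hs0 above]] := last_exit uv ch hup (lt_le_trans pq hqv).
have [e e0 below_q] : exists2 e : R, 0 < e & forall t, `|s0 - t| < e -> h t < q.
  have : \forall t \near s0, h t < q by apply: (cvgr_lt (h s0) (ch s0)); rewrite hs0.
  by move=> [e e0 he]; exists e.
(* Before [v], and close enough to [s0] for [h] to stay below [q]. *)
pose s1 := Num.min (s0 + e / 2) ((s0 + v) / 2).
have s01 : s0 < s1.
  by rewrite lt_min ltrDl divr_gt0//= ltr_pdivlMr// mulr_natr mulr2n ltrD2l.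
have s1v : s1 < v.
  apply: (@le_lt_trans _ _ ((s0 + v) / 2)); first by rewrite ge_min lexx orbT.
  by rewrite ltr_pdivrMr// mulr_natr mulr2n ltrD2r.
have s1e : s1 < s0 + e.
  apply: (@le_lt_trans _ _ (s0 + e / 2)); first by rewrite ge_min lexx.
  by rewrite ltrD2l gtr_pMr// invf_lt1 ?ltr1n.
have in_pq t : s0 < t <= s1 -> p < h t < q.
  move=> /andP[t0 t1]; rewrite above ?t0 ?(le_trans t1 (ltW s1v))//=.
  apply: below_q; rewrite distrC gtr0_norm ?subr_gt0//.
  by rewrite ltrBlDl (le_lt_trans t1).
have [t /andP[t0 t1] [nEt sgt]] : exists2 t, s0 < t < s1 & ~ E t /\ 0 < sg t.
  apply: contrapT => none.
  have : h s1 <= h s0.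
    apply: (le_of_derive_le0_finite (ltW s01) ch fE) => t /andP[t0 t1] nEt.
    have tuv : u < t < v by rewrite (le_lt_trans us0 t0) (lt_trans t1 s1v).
    have [k k0 dk] := dh t tuv nEt; exists (k * sg t) => //.
    rewrite pmulr_rle0// leNgt; apply/negP => sgt; apply: none.
    by exists t => //; rewrite t0.
  by rewrite hs0 leNgt above// s01 ltW.
have tuv : u < t < v by rewrite (le_lt_trans us0 t0) (lt_trans t1 s1v).
have [k k0 dk] := dh t tuv nEt.
have [e1 e10 loc] := is_derive_gt0_local dk (mulr_gt0 k0 sgt).
have [e2 e20 pos] : exists2 e : R, 0 < e & forall w, `|t - w| < e -> 0 < sg w.
  have : \forall w \near t, 0 < sg w by apply: (cvgr_gt (sg t) (csg t tuv)).
  by move=> [e' e'0 he]; exists e'.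
pose d := Num.min (Num.min e1 e2) (s1 - t).
have d0 : 0 < d by rewrite !lt_min e10 e20 subr_gt0.
pose t' := t + d / 2.
have tt' : t < t' by rewrite ltrDl divr_gt0.
have t'd : t' < t + d by rewrite ltrD2l gtr_pMr// invf_lt1 ?ltr1n.
have t's1 : t' < s1.
  by rewrite (lt_le_trans t'd)// -lerBrDl ge_min lexx orbT.
have t'e1 : t' < t + e1.
  by rewrite (lt_le_trans t'd)// lerD2l !ge_min lexx.
have t'e2 : t' < t + e2.
  by rewrite (lt_le_trans t'd)// lerD2l !ge_min lexx orbT.
have htt' : h t < h t' by apply: (loc t').1; rewrite tt'.
have /andP[pht _] := in_pq t (introT andP (conj t0 (ltW t1))).
have /andP[_ hqt'] := in_pq t' (introT andP (conj (lt_trans t0 tt') (ltW t's1))).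
exists (h t), (h t'); split; rewrite ?ltW// => y /andP[y1 y2].
have yb : Num.min (h t) (h t') <= y <= Num.max (h t) (h t').
  by rewrite ge_min le_max (ltW y1) (ltW y2) orbT.
have [w] := IVT (ltW tt') (continuous_subspaceT ch) yb.
rewrite in_itv/= => /andP[w1 w2] hw; exists w.
  by rewrite (lt_le_trans _ w1) ?(le_lt_trans us0)//= (le_lt_trans w2)// (lt_trans t's1).
split=> //; rewrite gt_eqF//; apply: pos; rewrite distrC ger0_norm ?subr_ge0//.
by rewrite ltrBlDl (le_lt_trans w2).
Qed.

Lemma regular_levels (h sg : R -> R) (u v p q : R) (E : set R) :
  u <= v -> p < q -> continuous h -> finite_set E ->
  (forall t, u < t < v -> {for t, continuous sg}) ->
  (forall t, u < t < v -> ~ E t -> exists2 k : R, 0 < k & is_derive t 1 h (k * sg t)) ->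
  Num.min (h u) (h v) <= p -> q <= Num.max (h u) (h v) ->
  exists p' q', [/\ p <= p', p' < q', q' <= q &
    forall y, p' < y < q' -> exists2 t, u < t < v & h t = y /\ sg t != 0].
Proof.
move=> uv pq ch fE csg dh.
case: (leP (h u) (h v)) => [huv hup hvq|hvu hvp huq].
  exact: (@regular_levels_up h sg u v p q E).
have chN : continuous (fun t => - h t) by exact: continuous_opp.
have csgN t : u < t < v -> {for t, continuous (fun t => - sg t)}.
  by move=> /csg ct; exact: (cvgN ct).
have dhN t : u < t < v -> ~ E t -> exists2 k : R, 0 < k & is_derive t 1 (fun t =>
  - h t) (k * - sg t).
  move=> tuv nE; have [k k0 dk] := dh t tuv nE; exists k => //.
  by rewrite mulrN; exact: is_deriveN.
have [|||p' [q' [p1 p2 p3 lev]]] :=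
    @regular_levels_up (fun t => - h t) (fun t =>
      - sg t) u v (- q) (- p) E uv _ chN fE csgN dhN.
- by rewrite ltrN2.
- by rewrite lerN2.
- by rewrite lerN2.
exists (- q'), (- p'); split; rewrite ?ltrN2// 1?lerNr 1?lerNl// => y /andP[y1 y2].
have [|t tuv [ty sgt]] := lev (- y); first by rewrite ltrNr y2 ltrNl y1.
by exists t => //; split; [exact: oppr_inj | rewrite oppr_eq0 in sgt].
Qed.

(** [regular_levels] returns an interval inside the given one, so it can be applied to one index
    after the other, shrinking the interval each time. *)
Lemma common_regular_levels (I : eqType) (r : seq I) (h sg : R -> R) (u v : I -> R)
    (p q : R) (E : set R) :
  p < q -> continuous h -> finite_set E ->
  (forall i t, i \in r -> u i < t < v i -> {for t, continuous sg}) ->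
  (forall i t, i \in r -> u i < t < v i -> ~ E t ->
    exists2 k : R, 0 < k & is_derive t 1 h (k * sg t)) ->
  (forall i, i \in r -> [/\ u i <= v i, Num.min (h (u i)) (h (v i)) <= p &
    q <= Num.max (h (u i)) (h (v i))]) ->
  exists p' q', [/\ p <= p', p' < q', q' <= q &
    forall i y, i \in r -> p' < y < q' ->
      exists2 t, u i < t < v i & h t = y /\ sg t != 0].
Proof.
move=> pq ch fE; elim: r => [|i r IH] csg dh cross; first by exists p, q; split.
have [||i' i'r|p1 [q1 [pp1 pq1 qq1 lev1]]] := IH.
- by move=> j t jr; apply: csg; rewrite inE jr orbT.
- by move=> j t jr; apply: dh; rewrite inE jr orbT.
- by apply: cross; rewrite inE i'r orbT.
have iin : i \in i :: r by rewrite inE eqxx.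
have [uv hp hq] := cross i iin.
have [p2 [q2 [pp2 pq2 qq2 lev2]]] := @regular_levels h sg (u i) (v i) p1 q1 E uv pq1 ch fE
  (fun t => csg i t iin) (fun t => dh i t iin) (le_trans hp pp1) (le_trans qq1 hq).
exists p2, q2; split => //; rewrite ?(le_trans pp1)// ?(le_trans qq2)//.
move=> j y; rewrite inE => /predU1P[->|jr] /andP[y1 y2]; first by apply: lev2; rewrite y1.
by apply: lev1 => //; rewrite (le_lt_trans pp2 y1) (lt_le_trans y2 qq2).
Qed.

Lemma interval_avoids_finite (p q : R) (V : set R) : p < q -> finite_set V ->
  exists2 y, p < y < q & ~ V y.
Proof.
move=> + /finite_seqP[r ->]; elim: r p q => [|x r IH] p q pq.
  by exists ((p + q) / 2) => //; have [-> ->] := midf_lt pq.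
have [/andP[px xq]|xpq] := boolP (p < x < q).
  have [y /andP[py yx] yr] := IH p x px; exists y; first by rewrite py (lt_trans yx).
  by rewrite /= inE => /predU1P[yx'|//]; rewrite yx' ltxx in yx.
have [y ypq yr] := IH p q pq; exists y => //.
by rewrite /= inE => /predU1P[yx|//]; rewrite -yx ypq in xpq.
Qed.

Lemma finite_gap (y : R) (V : set R) : finite_set V -> ~ V y ->
  exists2 e : R, 0 < e & forall x, V x -> e <= `|x - y|.
Proof.
move=> /finite_seqP[r ->]; elim: r => [|x r IH] nV; first by exists 1.
have [|e e0 he] := IH; first by move=> yr; apply: nV; rewrite /= inE yr orbT.
have xy : 0 < `|x - y|.
  rewrite normr_gt0 subr_eq0; apply/eqP => xy; apply: nV.
  by rewrite /= -xy inE eqxx.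
exists (Num.min e `|x - y|); first by rewrite lt_min e0.
move=> z; rewrite /= inE => /predU1P[->|zr]; first by rewrite ge_min lexx orbT.
by rewrite ge_min he.
Qed.

End RegularLevels.

(** * Total variation of the height along the path *)

Section DirectionalVariation.
Variables (R : realType) (s : nat) (al : 'I_s -> R[i]) (n : 'I_s -> nat).
Variables (c : R -> R[i]) (a b : R) (E : set R).
Hypothesis s_gt0 : (0 < s)%N.
Hypothesis n_gt0 : forall i, (0 < n i)%N.
Hypothesis dc : descent_curve al n c a b E.
Hypothesis ex : exposed_end c a b.

(** By [sum_lengths_le] it suffices to bound, for each generic height, the number of polygon sides
    crossing it. Each such side gives a transversal crossing of one common nearby line by the path,
    and distinct sides give distinct times as their open time intervals are disjoint. *)
Lemma vertical_variation_le (m : nat) (tau : nat -> R) (lo hi : R) :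
  (forall k, (k < m)%N -> tau k < tau k.+1) -> a <= tau 0%N -> tau m <= b ->
  lo <= hi -> (forall t, a <= t <= b -> lo <= Im (c t) <= hi) ->
  \sum_(k < m) `|Im (c (tau k.+1)) - Im (c (tau k))| <= (2 * s).-1%:R * (hi - lo).
Proof.
move=> tau_inc atau taub lohi bounds.
have [cc decr fE der] := dc.
have tau_le i j : (i <= j <= m)%N -> tau i <= tau j.
  elim: j => [|j IH]; first by rewrite leqn0 => /andP[/eqP->].
  move=> /andP[]; rewrite leq_eqVlt => /predU1P[-> //|ij jm].
  by apply: (le_trans (IH _) (ltW (tau_inc j jm))); rewrite -ltnS ij ltnW.
have tau_ab k : (k <= m)%N -> a <= tau k <= b.
  move=> km; rewrite (le_trans atau) ?tau_le//= (le_trans _ taub)//.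
  by rewrite tau_le// km leqnn.
pose h t := Im (c t).
have ch : continuous h := cc.2.
pose mn (k : 'I_m) := Num.min (h (tau k)) (h (tau k.+1)).
pose mx (k : 'I_m) := Num.max (h (tau k)) (h (tau k.+1)).
have -> : \sum_(k < m) `|h (tau k.+1) - h (tau k)| = \sum_(k < m) (mx k - mn k).
  apply: eq_bigr => k _; rewrite /mx /mn.
  case: (leP (h (tau k)) (h (tau k.+1))) => hk; first by rewrite ger0_norm// subr_ge0.
  by rewrite ltr0_norm ?subr_lt0// opprB.
have hk k : (k <= m)%N -> lo <= h (tau k) <= hi by move=> km; apply: bounds; exact: tau_ab.
pose V : set R := [set h (tau k) | k in `I_m.+1].
have fV : finite_set V by apply: finite_image; exact: finite_II.
apply: (@sum_lengths_le R m mn mx _ lo hi V lohi _ _ _ fV).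
- move=> k; rewrite /mn le_min; have /andP[-> _] := hk k (ltnW (ltn_ord k)).
  by have /andP[-> _] := hk k.+1 (ltn_ord k).
- by move=> k; rewrite /mn /mx ge_min le_max lexx.
- move=> k; rewrite /mx ge_max; have /andP[_ ->] := hk k (ltnW (ltn_ord k)).
  by have /andP[_ ->] := hk k.+1 (ltn_ord k).
move=> y nVy; have [e e0 gap] := finite_gap fV nVy.
have Vtau k : (k <= m)%N -> V (h (tau k)) by move=> km; exists k.
pose S := [set k : 'I_m | (mn k < y < mx k)%R]%SET.
(* All vertices are at vertical distance at least [e] from [y], so a side through height [y] crosses
   the whole band of half-width [e / 2]. *)
have cross (k : 'I_m) : k \in enum S -> [/\ tau k <= tau k.+1,
  mn k <= y - e / 2 & y + e / 2 <= mx k].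
  rewrite mem_enum inE => /andP[y1 y2]; split; first exact/ltW/tau_inc.
    have gk : e <= `|mn k - y|.
      rewrite /mn; case: (leP (h (tau k)) (h (tau k.+1))) => _; apply/gap/Vtau => //.
      exact: ltnW.
    by move: gk; rewrite ltr0_norm ?subr_lt0//; lra.
  have gk : e <= `|mx k - y|.
    rewrite /mx; case: (leP (h (tau k)) (h (tau k.+1))) => _; apply/gap/Vtau => //.
    exact: ltnW.
  by move: gk; rewrite gtr0_norm ?subr_gt0//; lra.
have in_ab (k : 'I_m) t : tau k < t < tau k.+1 -> a < t < b.
  move=> /andP[t1 t2]; have /andP[ak _] := tau_ab k (ltnW (ltn_ord k)).
  by have /andP[_ kb] := tau_ab k.+1 (ltn_ord k);
    rewrite (le_lt_trans ak t1) (lt_le_trans t2 kb).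
pose sg t := - log_slope al n 'i%C (c t).
have csg (k : 'I_m) t : k \in enum S -> tau k < t < tau k.+1 -> {for t, continuous sg}.
  move=> _ /in_ab /andP[ta tb].
  have tal i : c t != al i.
    apply/eqP => e'; have := decr t b (ltW ta) tb (lexx b).
    have -> : modsq al n (c t) = 0; last by rewrite ltNge modsq_ge0.
    rewrite /modsq (bigD1 i)//= e' subrr (_ : normsq 0 = 0).
      by rewrite expr0n eqn0Ngt n_gt0 mul0r.
    by rewrite /normsq /= expr0n addr0.
  by have := @log_slope_continuous R s al n _ c 'i%C t cc tal => /cvgN.
have dh (k : 'I_m) t : k \in enum S -> tau k < t < tau k.+1 -> ~ E t ->
    exists2 x : R, 0 < x & is_derive t 1 h (x * sg t).
  move=> _ /in_ab tab nE; have [x x0 /(_ 'i%C) dx] := der t tab nE; exists x => //.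
  rewrite /sg mulrN -mulNr; have -> // : h = (fun u => Re (conjc 'i%C * c u)).
  by apply/funext => u; rewrite /h !ReImE; ring.
have pq : y - e / 2 < y + e / 2 by lra.
have [p' [q' [_ p'q' _ lev]]] := common_regular_levels pq ch fE csg dh cross.
(* Avoiding the heights of the roots, of the exceptional times and of both ends leaves only good
   crossings on the line. *)
pose bad : set R := (range (fun i : 'I_s => Im (al i))) `|` (h @` (E `|` [set a; b])).
have fbad : finite_set bad.
  rewrite finite_setU; split; first exact: finite_image.
  apply: finite_image; rewrite finite_setU; split=> //; exact: finite_set2.
have [y' y'pq nbad] := interval_avoids_finite p'q' fbad.
have /choice[t tP] : forall k : 'I_m, exists t : R, k \in S ->
    [/\ tau k < t < tau k.+1, h t = y' & sg t != 0].
  move=> k; have [kS|kS] := boolP (k \in S); last by exists 0.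
  have [|t tk [ty st]] := lev k y' _ y'pq; first by rewrite mem_enum.
  by exists t.
have : (size [seq t k | k <- enum S] <= (2 * s).-1)%N.
  apply: (crossings_le s_gt0 n_gt0 dc ex (y := y')).
  - rewrite map_inj_in_uniq ?enum_uniq// => k k';
    rewrite !mem_enum => /tP[/andP[k1 k2] _ _] /tP[/andP[k1' k2'] _ _] ett.
    apply: ord_inj; apply/eqP; rewrite eqn_leq [(k <= k')%N]leqNgt [(k' <= k)%N]leqNgt.
    apply/andP; split; apply/negP => kk.
      have : tau k'.+1 <= tau k by apply: tau_le; rewrite kk ltnW.
      by rewrite leNgt (lt_trans k1)// ett.
    have : tau k.+1 <= tau k' by apply: tau_le; rewrite kk ltnW.
    by rewrite leNgt (lt_trans k1')// -ett.
  - by move=> i; apply/eqP => e'; apply: nbad; left; exists i.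
  - move=> w /andP[aw wb] wy; split.
      rewrite !lt_neqAle aw wb !andbT; apply/andP; split; apply/eqP => e'; apply: nbad;
        right.
        by exists a; [right; left | rewrite /h e'].
      by exists b; [right; right | rewrite /h -e'].
    by move=> Ew; apply: nbad; right; exists w => //; left.
  - move=> w /mapP[k]; rewrite mem_enum => /tP[tk ty st] ->; split=> //.
      by have /andP[/ltW-> /ltW->] := in_ab _ _ tk.
    by rewrite /sg oppr_eq0 in st.
by rewrite size_map -cardE.
Qed.

End DirectionalVariation.

(** * Separation from the convex hull, and stability of half-planes *)

Section HullSeparation.
Variables (R : realType) (s : nat) (al : 'I_s -> R[i]).

Lemma Re_sum (I : Type) (r : seq I) (F : I -> R[i]) :
  Re (\sum_(i <- r) F i) = \sum_(i <- r) Re (F i).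
Proof. by elim: r => [|i r IH]; rewrite ?big_nil// !big_cons cReD IH. Qed.

Lemma Im_sum (I : Type) (r : seq I) (F : I -> R[i]) :
  Im (\sum_(i <- r) F i) = \sum_(i <- r) Im (F i).
Proof. by elim: r => [|i r IH]; rewrite ?big_nil// !big_cons cImD IH. Qed.

Lemma ccontinuous_sum (T : topologicalType) (I : Type) (r : seq I) (F : I -> T -> R[i]) :
  (forall i, ccontinuous (F i)) -> ccontinuous (fun x => \sum_(i <- r) F i x).
Proof.
move=> cF; elim: r => [|i r IH].
  by under eq_fun do rewrite big_nil; exact: ccontinuous_cst.
by under eq_fun do rewrite big_cons; exact: ccontinuousD.
Qed.

Definition barycenter (w : 'I_s -> R) : R[i] := \sum_i ((w i)%:C)%C * al i.

Definition weights (w : 'I_s -> R) := (forall i, 0 <= w i) /\ \sum_i w i = 1.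

(* [e] points from [z] to the nearest point of the hull. *)
Lemma hull_separation (z : R[i]) : (0 < s)%N ->
  (forall w, weights w -> barycenter w <> z) ->
  exists2 e : R[i], 0 < normsq e & forall i, normsq e <= Re (conjc e * (al i - z)).
Proof.
move=> s_gt0 notin.
pose A : set 'rV[R]_s := [set v | forall i, v ord0 i \in `[0, 1]%R] `&`
  [set v | \sum_i v ord0 i = 1].
have coordc (i : 'I_s) : continuous (fun v : 'rV[R]_s =>
  v ord0 i) by exact: coord_continuous.
have A0 : A !=set0.
  exists (\row_i (i == Ordinal s_gt0)%:R); split=> /=.
    by move=> i; rewrite mxE in_itv/=; case: eqP; rewrite ?ler01 ?lexx.
  rewrite (bigD1 (Ordinal s_gt0))//= mxE eqxx big1 ?addr0// => i /negbTE ni.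
  by rewrite mxE ni.
have cA : compact A.
  apply: compact_closedI;
    first by apply: (@rV_compact _ _ (fun=> `[0%R : R, 1%R]%classic)) => _;
      exact: segment_compact.
  have cs : continuous (fun v : 'rV[R]_s => \sum_i v ord0 i) by exact: continuous_fsum.
  by apply: (@preimage_closed _ _ (fun v : 'rV[R]_s => \sum_i v ord0 i) [set 1%R]) => //;
    exact: closed_eq.
pose N (v : 'rV[R]_s) := normsq (barycenter (fun i => v ord0 i) - z).
have cN : continuous N.
  apply: continuous_normsq;
    apply: (@ccontinuousD _ _ (fun v : 'rV[R]_s => barycenter (fun i => v ord0 i))).
    apply: ccontinuous_sum => i.
    apply: (@ccontinuousM _ _ (fun v : 'rV[R]_s => ((v ord0 i)%:C)%C));
      last exact: ccontinuous_cst.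
    exact: (ccontinuous_real (coordc i)).
  exact: ccontinuous_cst.
have [v] := compact_EVT_min A0 cA (continuous_subspaceT cN).
rewrite inE => -[v01 v1] vmin.
pose k := barycenter (fun i => v ord0 i); pose e := k - z.
have wv : weights (fun i => v ord0 i).
  by split=> // i; have := v01 i; rewrite /= in_itv/= => /andP[].
exists e; first by rewrite normsq_gt0 subr_eq0; apply/eqP; exact: notin.
move=> i.
have -> : Re (conjc e * (al i - z)) = Re (conjc e * (al i - k)) + normsq e.
  by rewrite /e /normsq !ReImE; ring.
rewrite lerDr leNgt; apply/negP => neg.
set q := Re _ in neg; pose d := normsq (al i - k).
have d0 : 0 <= d by exact: normsq_ge0.
(* Moving by [t] from [k] towards [al i] changes the squared distance to [z] by
   [t * (2 * q + t * d)]. With [q < 0] this bound on [t] makes it negative; [d + 1] avoids a zero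
   denominator, and [t <= 1] keeps the weights nonnegative. *)
pose t := Num.min 1 (- q / (d + 1)).
have d1 : 0 < d + 1 by rewrite ltr_wpDl.
have t0 : 0 < t by rewrite lt_min ltr01 divr_gt0// oppr_gt0.
have t1 : t <= 1 by rewrite ge_min lexx.
have td : t * (d + 1) <= - q by rewrite -ler_pdivlMr// ge_min lexx orbT.
pose v' : 'rV[R]_s := \row_j ((1 - t) * v ord0 j + t * (j == i)%:R).
have sum_delta (F : 'I_s -> R) : \sum_j (j == i)%:R * F j = F i.
  rewrite (bigD1 i)//= eqxx mul1r big1 ?addr0// => j /negbTE ->.
  by rewrite mul0r.
have v'A : v' \in A.
  rewrite inE; split=> /=.
    move=> j; have := v01 j; rewrite /= !in_itv/= mxE => /andP[vj0 vj1].
    have b0 : 0 <= ((j == i)%:R : R) by [].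
    have b1 : ((j == i)%:R : R) <= 1 by case: eqP.
    apply/andP; split; first by rewrite addr_ge0// mulr_ge0// ?subr_ge0// ltW.
    rewrite -[leRHS](subrK t); apply: lerD; last by rewrite ler_piMr// ltW.
    by rewrite ler_piMr// subr_ge0.
  under eq_bigr do rewrite mxE.
  rewrite big_split/= -!mulr_sumr v1 mulr1.
  have := sum_delta (fun=> 1); under eq_bigr do rewrite mulr1.
  by move=> ->; rewrite mulr1 subrK.
have := vmin v' v'A.
have kE : barycenter (fun i => v' ord0 i) - z = e + ((t)%:C)%C * (al i - k).
  have -> : barycenter (fun i => v' ord0 i) = ((1 - t)%:C)%C * k + (t%:C)%C * al i.
    apply: complex_ext.
      have dRe : Re (al i) = \sum_j (j == i)%:R * Re (al j).
        by rewrite (sum_delta (fun j => Re (al j))).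
      rewrite Re_sum cReD !cReM Re_sum Re_real Im_real !mul0r !subr0 [in RHS]dRe !mulr_sumr.
      by rewrite -big_split/=; apply: eq_bigr => j _; rewrite !cReM !Re_real !Im_real mxE;
        ring.
    have dIm : Im (al i) = \sum_j (j == i)%:R * Im (al j).
      by rewrite (sum_delta (fun j => Im (al j))).
    rewrite Im_sum cImD !cImM Im_sum Re_real Im_real !mul0r !addr0 [in RHS]dIm !mulr_sumr.
    by rewrite -big_split/=; apply: eq_bigr => j _; rewrite !cImM !Re_real !Im_real mxE;
      ring.
  by rewrite /e rmorphB rmorph1; ring.
rewrite /N kE -/k -/e.
have -> : normsq (e + (t%:C)%C * (al i - k)) = normsq e + t * (2 * q + t * d).
  by rewrite /q /d /normsq !ReImE; ring.
rewrite lerDl pmulr_rge0// leNgt => /negP; apply.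
by clear -td neg t0; lra.
Qed.

End HullSeparation.

Section HalfPlanes.
Variables (R : realType) (s : nat) (al : 'I_s -> R[i]) (n : 'I_s -> nat).

(** Beyond the line every summand of [log_slope] is nonnegative, as in the proof of Gauss-Lucas, so
    descent cannot go further out after a last exit. *)
Lemma descent_stays_in_halfplane (c : R -> R[i]) (a b : R) (E : set R) (v : R[i]) (M : R) :
  descent_curve al n c a b E -> (forall i, Re (conjc v * al i) <= M) ->
  Re (conjc v * c a) <= M -> forall t, a <= t <= b -> Re (conjc v * c t) <= M.
Proof.
move=> [cc _ fE der] alM caM t /andP[at_ tb]; rewrite leNgt; apply/negP => ctM.
pose g t := Re (conjc v * c t).
have cg : continuous g by have [] : ccontinuous (fun t => conjc v * c t) by ccont.
have [s0 [/andP[as0 s0t] gs0 above]] := last_exit at_ cg caM ctM.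
suff : g t <= g s0 by rewrite gs0 leNgt ctM.
apply: (le_of_derive_le0_finite (ltW s0t) cg fE) => x /andP[x0 xt] nE.
have [k k0 dk] := der x (introT andP (conj (le_lt_trans as0 x0) (lt_le_trans xt tb))) nE.
exists (- k * log_slope al n v (c x)); last exact: dk.
rewrite mulNr oppr_le0 mulr_ge0//; first exact: ltW.
apply: sumr_ge0 => i _; rewrite mulr_ge0// divr_ge0 ?normsq_ge0//.
rewrite mulrBr cReD cReN subr_ge0 (le_trans (alM i))// ltW//.
by apply: above; rewrite x0 ltW.
Qed.

End HalfPlanes.

(** * From [Rcomplex R] to real coordinates, and the gradient of the modulus *)

Section RcomplexTopology.
Variable R : realType.

Lemma normc_Re (z : Rcomplex R) : `|Re z| <= normc z.
Proof.
by case: z => x y /=; rewrite -sqrtr_sqr ler_wsqrtr// lerDl sqr_ge0.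
Qed.

Lemma normc_Im (z : Rcomplex R) : `|Im z| <= normc z.
Proof.
by case: z => x y /=; rewrite -sqrtr_sqr ler_wsqrtr// lerDr sqr_ge0.
Qed.

Lemma cvg_Re (T : Type) (F : set_system T) (FF : Filter F) (f : T -> Rcomplex R)
    (l : Rcomplex R) : f @ F --> l -> (fun t => Re (f t)) @ F --> Re l.
Proof.
move=> /cvgrPdist_lt fl; apply/cvgrPdist_lt => e /fl; apply: filterS => t.
by apply: le_lt_trans; rewrite -cReN -cReD; exact: normc_Re.
Qed.

Lemma cvg_Im (T : Type) (F : set_system T) (FF : Filter F) (f : T -> Rcomplex R)
    (l : Rcomplex R) : f @ F --> l -> (fun t => Im (f t)) @ F --> Im l.
Proof.
move=> /cvgrPdist_lt fl; apply/cvgrPdist_lt => e /fl; apply: filterS => t.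
by apply: le_lt_trans; rewrite -cImN -cImD; exact: normc_Im.
Qed.

Lemma ReZ (h : R) (z : Rcomplex R) : Re (h *: z) = h * Re z.
Proof. by case: z. Qed.

Lemma ImZ (h : R) (z : Rcomplex R) : Im (h *: z) = h * Im z.
Proof. by case: z. Qed.

Lemma is_derive_Re (g : R -> Rcomplex R) (t : R) : derivable g t 1 ->
  is_derive t 1 (fun u => Re (g u)) (Re ('D_1 g t)).
Proof.
move=> dg.
have cv : (fun h : R => h^-1 *: (Re (g (h *: 1 + t)) - Re (g t))) @ 0^' --> Re ('D_1 g t).
  have -> : (fun h : R => h^-1 *: (Re (g (h *: 1 + t)) - Re (g t))) =
      (fun h : R => Re (h^-1 *: (g (h *: 1 + t) - g t))).
    by apply/funext => h; rewrite ReZ cReD cReN.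
  exact: cvg_Re dg.
by apply: DeriveDef; [apply/cvg_ex; exists (Re ('D_1 g t)) | exact: cvg_lim cv].
Qed.

Lemma is_derive_Im (g : R -> Rcomplex R) (t : R) : derivable g t 1 ->
  is_derive t 1 (fun u => Im (g u)) (Im ('D_1 g t)).
Proof.
move=> dg.
have cv : (fun h : R => h^-1 *: (Im (g (h *: 1 + t)) - Im (g t))) @ 0^' --> Im ('D_1 g t).
  have -> : (fun h : R => h^-1 *: (Im (g (h *: 1 + t)) - Im (g t))) =
      (fun h : R => Im (h^-1 *: (g (h *: 1 + t) - g t))).
    by apply/funext => h; rewrite ImZ cImD cImN.
  exact: cvg_Im dg.
by apply: DeriveDef; [apply/cvg_ex; exists (Im ('D_1 g t)) | exact: cvg_lim cv].
Qed.

Lemma derive_directional (g : Rcomplex R -> R) (z v : Rcomplex R) (d : R) :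
  is_derive (0 : R) 1 (fun e : R => g (z + (e%:C)%C * v)) d -> 'D_v g z = d.
Proof.
move=> [_ <-]; rewrite /derive.
suff -> : (fun h : R => h^-1 *: (g (h *: v + z) - g z)) =
    (fun h : R => h^-1 *: (g (z + ((h *: (1 : R) + 0 : R)%:C)%C * v) - g (z + ((0 :
      R)%:C)%C * v))) by [].
apply/funext => h; rewrite rmorph0 mul0r !addr0; congr (_ *: (g _ - _)).
rewrite addrC; congr (_ + _); case: v => x y.
by apply: complex_ext; rewrite /GRing.scale/= ?mul0r ?subr0 ?addr0 ?mulr1.
Qed.

Lemma Re_conj_le (v z : R[i]) : Re (conjc v * z) <= Num.sqrt (normsq v) * normc z.
Proof.
rewrite normcE_sq -sqrtrM ?normsq_ge0//.
apply: le_trans (ler_norm _) _; rewrite -sqrtr_sqr ler_wsqrtr//.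
rewrite -subr_ge0 (_ : _ - _ = Im (conjc v * z) ^+ 2) ?sqr_ge0//.
by rewrite /normsq !ReImE; ring.
Qed.

End RcomplexTopology.

Section RootPolynomial.
Variables (R : realType) (s : nat) (al : 'I_s -> Rcomplex R) (n : 'I_s -> nat).

Lemma poly_modulus_prod (z : Rcomplex R) :
  poly_modulus (\prod_(i < s) ('X - (al i)%:P) ^+ n i) z = Num.sqrt (modsq al n z).
Proof.
rewrite /poly_modulus horner_prod /modsq normcE_sq; congr Num.sqrt.
elim/big_rec2: _ => [|i y x _ <-]; first by rewrite /normsq /= expr1n expr0n addr0.
rewrite horner_exp hornerXsubC.
transitivity (normsq (((z - al i) ^+ n i : R[i]) * (x : R[i]))) => //.
rewrite normsqM; congr (_ * _).
elim: (n i) => [|m IH]; first by rewrite !expr0 /normsq /= expr1n expr0n addr0.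
by rewrite !exprS -IH -normsqM.
Qed.

(** The gradient of [|f|] is [|f|] times that of [log |f|]; thus [r] is [|f|] at [z]. *)
Lemma gradient_poly_modulus (z : Rcomplex R) : (forall i, z != al i) ->
  let g := gradient (poly_modulus (\prod_(i < s) ('X - (al i)%:P) ^+ n i)) z in
  exists2 r : R, 0 < r & forall v : R[i], Re (conjc v * g) = r * log_slope al n v z.
Proof.
move=> zal g; pose m := modsq al n z.
have m0 : 0 < m by apply: prodr_gt0 => i _; rewrite exprn_gt0// normsq_gt0 subr_eq0.
have D (v : R[i]) : 'D_(v : Rcomplex R) (poly_modulus (\prod_(i < s) ('X - (al i)%:P) ^+ n
  i)) z
    = Num.sqrt m * log_slope al n v z.
  apply: derive_directional.
  under eq_fun do rewrite poly_modulus_prod.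
  have dm := is_derive_modsq n v zal.
  have m0' : 0 < modsq al n (z + (0%:C)%C * v) by rewrite rmorph0 mul0r addr0.
  have ds := @is_derive1_sqrt R _ m0'.
  have := @is_derive1_comp _ Num.sqrt (fun e : R =>
    modsq al n (z + (e%:C)%C * v)) 0 _ _ ds dm.
  move=> dc; apply: (is_derive_eq dc).
  rewrite rmorph0 mul0r addr0 -/m.
  have sm : Num.sqrt m != 0 by rewrite gt_eqF// sqrtr_gt0.
  by rewrite -[in LHS](sqr_sqrtr (ltW m0)); rewrite sqrtr_sqr ger0_norm ?sqrtr_ge0//; field.
exists (Num.sqrt m); first by rewrite sqrtr_gt0.
have lin (v p q : R[i]) : Re p = 1 -> Im p = 0 -> Re q = 0 -> Im q = 1 ->
    log_slope al n v z = Re v * log_slope al n p z + Im v * log_slope al n q z.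
  move=> p1 p2 q1 q2; rewrite /log_slope !mulr_sumr -big_split/=; apply: eq_bigr => i _.
  by rewrite !ReImE p1 p2 q1 q2; ring.
move=> v; rewrite /g /gradient (D (1 +i* 0)%C) (D (0 +i* 1)%C).
rewrite (lin v (1 +i* 0)%C (0 +i* 1)%C)// cReM cReJ cImJ.
set p := log_slope al n _ z; set q := log_slope al n _ z.
by rewrite /=; ring.
Qed.

End RootPolynomial.

Section RootFinite.
Variable R : realType.

Lemma finite_roots (F : closedFieldType) (p : {poly F}) : p != 0 -> finite_set [set z |
  root p z].
Proof.
move=> p0; have [r pE] := closed_field_poly_normal p.
apply/finite_seqP; exists r; apply/seteqP; split=> z /=.
  by rewrite pE rootZ ?lead_coef_eq0// root_prod_XsubC.
by rewrite pE rootZ ?lead_coef_eq0// root_prod_XsubC.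
Qed.

Lemma deriv_neq0 (F : numDomainType) (p : {poly F}) : (1 < size p)%N -> p^`() != 0.
Proof.
case sp : (size p) => [|[|m]] // _; apply/eqP => /(congr1 (fun q : {poly F} => q`_m)).
rewrite coef_deriv coef0 => /eqP; rewrite mulrn_eq0/= => /eqP pm.
have : lead_coef p == 0 by rewrite lead_coefE sp pm.
by rewrite lead_coef_eq0 -size_poly_eq0 sp.
Qed.

End RootFinite.

(** * The given path as a descent curve *)

Section SteepestDescent.
Variables (R : realType) (s : nat) (al : 'I_s -> Rcomplex R) (n : 'I_s -> nat).
Variables (a b : R) (gamma : R -> Rcomplex R).
Hypothesis s_gt0 : (0 < s)%N.
Hypothesis n_gt0 : forall i, (0 < n i)%N.
Let f : {poly (Rcomplex R)} := \prod_(i < s) ('X - (al i)%:P) ^+ n i.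
Hypothesis ab : a <= b.
Hypothesis gamma_descent : steepest_descent_path f a b gamma.

(** Extended by constants outside [[a, b]], the path is continuous on all of [R]. *)
Definition clamped_path (t : R) : R[i] := gamma (Num.max a (Num.min t b)).

Lemma clamped_pathE t : a <= t <= b -> clamped_path t = gamma t.
Proof. by move=> /andP[at_ tb]; rewrite /clamped_path min_l// max_r. Qed.

Lemma clamped_path_continuous : ccontinuous clamped_path.
Proof.
have [cg _ _] := gamma_descent.
have hab u : `[a, b]%classic (Num.max a (Num.min u b)).
  by rewrite /= in_itv/= le_max ge_max lexx ab ge_min lexx orbT.
have cv t : (gamma \o (fun u => Num.max a (Num.min u b))) @ t -->
  (clamped_path t : Rcomplex R).
  apply: (@cvg_comp _ _ _ _ _ _ (within `[a, b] (nbhs (Num.max a (Num.min t b))))).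
    move=> P HP.
    have H : nbhs t [set u | `[a, b]%classic (Num.max a (Num.min u b)) ->
        P (Num.max a (Num.min u b))] := @continuous_clamp R a b t _ HP.
    suff : nbhs t [set u | P (Num.max a (Num.min u b))] by [].
    by apply: filterS H => u; apply; exact: hab.
  exact: ((subspace_continuousP _ _).1 cg).
split=> t; [exact: cvg_Re (cv t) | exact: cvg_Im (cv t)].
Qed.

Lemma root_size_f : (1 < size f)%N.
Proof.
have f0 : f != 0.
  by apply/prodf_neq0 => i _; rewrite expf_neq0// polyXsubC_eq0.
apply: (root_size_gt1 (a := al (Ordinal s_gt0)) f0).
rewrite /root /f horner_prod (bigD1 (Ordinal s_gt0))//= horner_exp !hornerE subrr.
by rewrite expr0n eqn0Ngt n_gt0 mul0r.
Qed.

(** The times at zeros of the derivative of [f] join the cuts in [E]; they are finitely many because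
    strict decrease of the modulus makes [gamma] injective. A modulus that still has to decrease is
    positive, so no root is met before [b]. *)
Lemma clamped_path_descent : exists E, descent_curve al n clamped_path a b E.
Proof.
have [_ decr [cuts der]] := gamma_descent.
have decr' t u : a <= t -> t < u -> u <= b ->
    modsq al n (clamped_path u) < modsq al n (clamped_path t).
  move=> at_ tu ub.
  have tab : a <= t <= b by rewrite at_ (le_trans (ltW tu)).
  have uab : a <= u <= b by rewrite ub (le_trans at_ (ltW tu)).
  have := decr t u; rewrite !in_itv/= => /(_ tab uab tu).
  rewrite !poly_modulus_prod -!clamped_pathE// => lt.
  have pos : 0 < modsq al n (clamped_path t).
    by rewrite -sqrtr_gt0 (le_lt_trans _ lt)// sqrtr_ge0.
  by move: lt; rewrite ltr_sqrt.
have pos t : a <= t -> t < b -> 0 < modsq al n (clamped_path t).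
  by move=> at_ tb; apply: le_lt_trans (decr' t b at_ tb (lexx b)); exact: modsq_ge0.
pose h (t : R) := Num.max a (Num.min t b).
pose E : set R := [set` cuts] `|` [set t | a <= t <= b /\ root f^`() (gamma t)].
have fE : finite_set E.
  rewrite finite_setU; split; first exact: finite_seq.
  pose B : set (Rcomplex R) := [set z | root f^`() z].
  have fB : finite_set B.
    apply: (@finite_roots R[i] f^`()); exact: (@deriv_neq0 R[i] f root_size_f).
  have inj : {in (fun t => `[a, b]%classic t /\ B (gamma t)) : set R &, injective gamma}.
    move=> t u; rewrite !inE /= !in_itv/= => -[tab _] [uab _] e.
    apply/eqP; rewrite eq_le !leNgt; apply/andP; split; apply/negP => lt.
      by have := decr u t; rewrite !in_itv/= e ltxx => /(_ uab tab lt).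
    by have := decr t u; rewrite !in_itv/= e ltxx => /(_ tab uab lt).
  have : finite_set (gamma @` (fun t => `[a, b]%classic t /\ B (gamma t))).
    by apply: sub_finite_set fB => _ [t [_ Bt] <-].
  rewrite (eq_finite_set (inj_card_eq inj)) => fin; apply: sub_finite_set fin => t [tab rt].
  by split=> //=; rewrite in_itv.
exists E; split=> //; first exact: clamped_path_continuous.
move=> t tab nE; have tab' : a <= t <= b by case/andP: tab => /ltW-> /ltW->.
have tcuts : t \notin cuts by apply/negP => tc; apply: nE; left.
have tin : t \in `]a, b[ by rewrite in_itv.
have [dg gv] := der t tin tcuts.
have mt : 0 < modsq al n (gamma t).
  by rewrite -clamped_pathE//; apply: pos; case/andP: tab => // /ltW.
have zal i : gamma t != al i.
  apply/eqP => e; move: mt; rewrite /modsq (bigD1 i)//= e subrr (_ : normsq 0 = 0).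
    by rewrite expr0n eqn0Ngt n_gt0 mul0r ltxx.
  by rewrite /normsq /= expr0n addr0.
have f0 : f.[gamma t] != 0.
  have : Num.sqrt (modsq al n (gamma t)) != 0 by rewrite gt_eqF// sqrtr_gt0.
  rewrite -poly_modulus_prod -/f; apply: contra => /eqP; rewrite /poly_modulus => ->.
  by rewrite ComplexField.Normc.normc0.
have f'0 : f^`().[gamma t] != 0 by apply/negP => r0; apply: nE; right.
have [k k0 dE] := gv f0 f'0.
have [r r0 gr] := gradient_poly_modulus n zal.
exists (k * r); first exact: mulr_gt0.
move=> v.
have near_eq : \near t, Re (conjc v * gamma t) = Re (conjc v * clamped_path t).
  have /andP[at_ tb] := tab.
  near=> u; rewrite clamped_pathE//.
  by apply/andP; split; apply: ltW; near: u; [exact: lt_nbhsr at_ | exact: lt_nbhsl tb].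
apply: (near_eq_is_derive near_eq).
have dRe := is_derive_Re dg; have dIm := is_derive_Im dg.
have -> : (fun u => Re (conjc v * gamma u)) = (fun u =>
  Re v * Re (gamma u) + Im v * Im (gamma u)).
  by apply/funext => u; rewrite cReM cReJ cImJ; ring.
have -> : - (k * r) * log_slope al n v (clamped_path t) =
    Re v * Re ('D_1 gamma t) + Im v * Im ('D_1 gamma t).
  by rewrite clamped_pathE// mulNr -mulrA -(gr v) dE cReN cImN ReZ ImZ cReM cReJ cImJ; ring.
by apply: is_deriveD; exact: is_derive_cmul.
Unshelve. all: by end_near.
Qed.

End SteepestDescent.

(** * The boundary of the convex hull *)

Section ConvexHull.
Variables (R : realType) (s : nat) (al : 'I_s -> Rcomplex R).
Hypothesis s_gt0 : (0 < s)%N.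

Lemma convex_hullP (z : Rcomplex R) :
  convex_hull al z <-> exists2 w, weights w & z = barycenter al w.
Proof.
have E w : \sum_(i < s) w i *: al i = barycenter al w.
  apply: eq_bigr => i _; case: (al i) => x y.
  by apply: complex_ext; rewrite /= ?mul0r ?subr0 ?addr0.
split=> [[w [w0 w1 ->]]|[w [w0 w1] ->]]; first by exists w.
by exists w; split.
Qed.

Lemma vertex_in_hull i : convex_hull al (al i).
Proof.
apply/convex_hullP; exists (fun j => (j == i)%:R).
  split=> [j|]; first by case: eqP.
  by rewrite (bigD1 i)//= eqxx big1 ?addr0// => j /negbTE ->.
rewrite /barycenter (bigD1 i)//= eqxx rmorph1 mul1r big1 ?addr0// => j /negbTE ->.
by rewrite rmorph0 mul0r.
Qed.

Lemma hull_halfplane (v : R[i]) (M : R) (z : Rcomplex R) :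
  (forall i, Re (conjc v * al i) <= M) -> convex_hull al z -> Re (conjc v * z) <= M.
Proof.
move=> alM /convex_hullP[w [w0 w1] ->].
rewrite /barycenter mulr_sumr Re_sum -[M]mul1r -w1 mulr_suml; apply: ler_sum => i _.
have -> : Re (conjc v * (((w i)%:C)%C * al i)) = w i * Re (conjc v * al i).
  by rewrite !ReImE; ring.
by rewrite ler_wpM2l.
Qed.

(** A boundary point is a limit of points outside the hull. A line separates each of these from the
    roots, and the curve, which starts in the hull, stays on their side. *)
Lemma boundary_exposed (n : 'I_s -> nat) (c : R -> R[i]) (a b : R) (E : set R) :
  a <= b -> descent_curve al n c a b E -> convex_hull al (c a) ->
  boundary (convex_hull al) (c b : Rcomplex R) -> exposed_end c a b.
Proof.
move=> ab dc ca [_ notint] d d0.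
have [z [zd zK]] : exists z : Rcomplex R, normsq (z - c b) < d /\ ~ convex_hull al z.
  apply: contrapT => none; apply: notint.
  rewrite /interior/=; apply/nbhs_normP; exists (Num.sqrt d) => /=;
    first by rewrite sqrtr_gt0.
  move=> z; rewrite /= => zd; apply: contrapT => zK; apply: none; exists z; split=> //.
  have {}zd : normc ((c b : Rcomplex R) - z) < Num.sqrt d by exact: zd.
  by move: zd; rewrite normcE_sq ltr_sqrt// -normsqN opprB.
have [w ww|e e0 sep] := @hull_separation R s al z s_gt0.
  by move=> wz; apply: zK; apply/convex_hullP; exists w.
exists z, e; split=> // t tab.
have eN x : Re (conjc (- e) * x) = - Re (conjc e * x) by rewrite !ReImE; ring.
have alM i : Re (conjc (- e) * al i) <= - (Re (conjc e * z) + normsq e).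
  by have := sep i; rewrite mulrBr cReD cReN eN; lra.
have := descent_stays_in_halfplane dc alM (hull_halfplane alM ca) tab.
by rewrite eN mulrBr cReD cReN; lra.
Qed.

End ConvexHull.

(** * Assembling the length bound *)

Lemma path_lt_nth (R : realType) (a b : R) (p : seq R) (k : nat) :
  path <%R a p -> (k < size p)%N -> nth b (a :: p) k < nth b (a :: p) k.+1.
Proof. by move=> /(pathP b) h /h. Qed.

Theorem theorem1p2 (R : realType) (s : nat) (alphas : 'I_s -> Rcomplex R)
    (n : 'I_s -> nat) (f : {poly (Rcomplex R)})
    (center : Rcomplex R) (radius : R)
    (alpha beta : Rcomplex R) (a b : R) (gamma : R -> Rcomplex R)
    (s_ge2 : (2 <= s)%N)
    (alphas_inj : injective alphas)
    (n_gt0 : forall i, (0 < n i)%N)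
    (fE : f = \prod_(i < s) ('X - (alphas i)%:P) ^+ n i)
    (K_disk : convex_hull alphas `<=` [set z | normc (z - center) <= radius])
    (beta_K : convex_hull alphas beta)
    (alpha_root : root f alpha)
    (alpha_boundary : boundary (convex_hull alphas) alpha)
    (ab : a <= b)
    (gamma_descent : steepest_descent_path f a b gamma)
    (gamma_a : gamma a = beta)
    (gamma_b : gamma b = alpha) :
  (curve_length a b gamma <= (2 * pi * s%:R * radius)%:E)%E.
Proof.
subst f; have s_gt0 : (0 < s)%N := ltnW s_ge2.
have [E dc] := clamped_path_descent s_gt0 n_gt0 ab gamma_descent.
pose c := clamped_path a b gamma.
have aab : a <= a <= b by rewrite lexx.
have bab : a <= b <= b by rewrite lexx andbT.
have ca : convex_hull alphas (c a) by rewrite /c clamped_pathE// gamma_a.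
have ex : exposed_end c a b.
  apply: (boundary_exposed s_gt0 ab dc ca).
  by rewrite clamped_pathE// gamma_b.
have radius0 : 0 <= radius.
  apply: le_trans (K_disk _ beta_K); rewrite /= normcE_sq; exact: sqrtr_ge0.
have in_disk (v : R[i]) t : normsq v = 1 -> a <= t <= b ->
    Re (conjc v * c t) <= Re (conjc v * center) + radius.
  move=> v1; apply: (descent_stays_in_halfplane dc).
    move=> i; have := K_disk _ (vertex_in_hull alphas i); rewrite /= => ir.
    have := Re_conj_le v (alphas i - center); rewrite v1 sqrtr1 mul1r mulrBr cReD cReN.
    by move=> h; rewrite -lerBlDl (le_trans h).
  have := K_disk _ ca; rewrite /= => ir.
  have := Re_conj_le v (c a - center); rewrite v1 sqrtr1 mul1r mulrBr cReD cReN.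
  by move=> h; rewrite -lerBlDl (le_trans h).
apply: ge_ereal_sup => _ [p [pp /eqP plast] <-]; rewrite lee_fin.
pose tau k := nth b (a :: p) k.
have tau_lt k : (k < size p)%N -> tau k < tau k.+1 by exact: path_lt_nth.
have taum : tau (size p) = b by rewrite -[RHS]plast; exact: (nth_last b (a :: p)).
have tau_ab k : (k <= size p)%N -> a <= tau k <= b.
  have part : itv_partition a b p by split=> //; exact/eqP.
  by move=> kp; rewrite /tau itv_partition_nth_ge// itv_partition_nth_le.
pose dX (k : 'I_(size p)) := Re (c (tau k.+1)) - Re (c (tau k)).
pose dY (k : 'I_(size p)) := Im (c (tau k.+1)) - Im (c (tau k)).
have -> : polygon_length a b gamma p = \sum_k Num.sqrt (dX k ^+ 2 + dY k ^+ 2).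
  rewrite /polygon_length big_mkord; apply: eq_bigr => k _.
  rewrite normcE_sq /normsq cReD cImD cReN cImN /dX /dY /c !clamped_pathE//.
    by apply: tau_ab; exact: ltnW.
  exact: tau_ab.
have directional x : \sum_k `|dX k * cos x + dY k * sin x| <= (2 * s).-1%:R * (2 * radius).
  (* Multiplication by [u] turns the projection on the direction of angle [x] into the height. *)
  pose u : R[i] := (sin x +i* cos x)%C.
  have u1 : normsq u = 1 by rewrite /normsq /= addrC cos2Dsin2.
  have dcu := descent_curve_rotate u1 dc; have exu := exposed_end_rotate u1 ex.
  have Imu z : Im (u * z) = Re z * cos x + Im z * sin x.
    by rewrite cImM /u /=; ring.
  pose y0 := Im (u * center).
  (* The scalar product with [v] is the height after rotation, so the half-planes given by [v] and
     [- v] confine it to a band of width [2 * radius]. *)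
  pose v : R[i] := 'i%C * conjc u.
  have v1 : normsq v = 1.
    have uJ : normsq (conjc u) = 1 by rewrite -u1 /normsq cReJ cImJ sqrrN.
    by rewrite /v normsqM uJ mulr1 /normsq !ReImE expr0n expr1n add0r.
  have Rev z : Re (conjc v * z) = Im (u * z) by rewrite /v !ReImE; ring.
  have RevN z : Re (conjc (- v) * z) = - Im (u * z) by rewrite -Rev !ReImE; ring.
  have bounds t : a <= t <= b -> y0 - radius <= Im (u * c t) <= y0 + radius.
    move=> tab; have := in_disk v t v1 tab; rewrite !Rev => ->; rewrite andbT.
    by have := in_disk (- v) t _ tab; rewrite normsqN v1 !RevN => /(_ erefl); lra.
  have taub : tau (size p) <= b by rewrite taum.
  have atau : a <= tau 0%N by exact: lexx.
  have y0r : y0 - radius <= y0 + radius by lra.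
  have := vertical_variation_le s_gt0 n_gt0 dcu exu tau_lt atau taub y0r bounds.
  rewrite (_ : y0 + radius - (y0 - radius) = 2 * radius); last by ring.
  apply: le_trans; apply: ler_sum => k _; rewrite le_eqVlt; apply/orP; left; apply/eqP.
  by congr (`|_|); rewrite !Imu /dX /dY; ring.
have := sum_length_le_projections directional.
set L := \sum_k _ => LB.
(* [LB] bounds [L] by [2 s - 1] times [pi * radius]; one more nonnegative [pi * radius] gives the
   stated constant. *)
have sE : (2 * s).-1%:R + 1 = 2 * s%:R :> R.
  by rewrite natr1 prednK ?natrM// muln_gt0.
have p0 : 0 <= pi * radius :> R by rewrite mulr_ge0// pi_ge0.
have -> : 2 * pi * s%:R * radius = ((2 * s).-1%:R + 1) * (pi * radius) :> R.
  by rewrite sE; ring.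
by move: LB p0; set q := (2 * s).-1%:R; set r := pi * radius;
  rewrite (_ : pi * (q * (2 * radius)) = 2 * (q * r)) /r; [lra | ring].
Qed.
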